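(* Let $m$ be a positive integer with $a(m)\equiv0\pmod 8$. Write the prime factorization of $4m+1$ as $4m+1=\prod_{i=1}^{u}h_i\prod_{j=1}^{v}g_j^{\alpha_j}$, where the $h_i$ are the primes dividing $4m+1$ exactly once and the $g_j$ are the primes dividing it with exponent $\alpha_j\ge2$. Then for every integer $n\ge1$ with $\gcd\!\left(n,\,2\prod_{j=1}^{v}g_j^{\alpha_j}\right)=1$, $$b\!\left(18mn^2+\frac{9n^2-1}{2}\right)\equiv 0\pmod{72}.$$
   Context: The mock theta function $\mathcal{B}(q)=\sum_{n\ge0}\frac{q^n(-q;q^2)_n}{(q;q^2)_{n+1}}=\sum_{n\ge0}b(n)q^n$, $(a;q)_n=\prod_{j=0}^{n-1}(1-aq^j)$. The integers $a(n)$ are defined by $\sum_{n\ge0}a(n)q^n=f_1^4f_2$, where $f_m:=(q^m;q^m)_\infty$. *)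

(* Defs.v *)
(* Formal power series in q with integer coefficients are
   represented by their coefficient functions nat -> int. *)
From mathcomp Require Import all_boot all_order all_algebra.
Set Implicit Arguments. Unset Strict Implicit. Unset Printing Implicit Defensive.
Import GRing.Theory Num.Theory.
Local Open Scope ring_scope.

Definition ps := nat -> int.

Definition psmul (f g : ps) : ps := fun n => \sum_(i < n.+1) f i * g (n - i)%N.
Definition ps1 : ps := fun n => (n == 0%N)%:R.
Definition psprod (s : seq ps) : ps := foldr psmul ps1 s.
Definition psX (k : nat) : ps := fun n => (n == k)%:R.
Definition onePlusX (d : nat) : ps := fun n => ps1 n + psX d n.
Definition oneMinusX (d : nat) : ps := fun n => ps1 n - psX d n.
(* 1/(1 - q^d) = sum_k q^(d k), for d >= 1 *)
Definition geomX (d : nat) : ps := fun n => (d %| n)%:R.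

Definition poch_mq (k : nat) : ps := psprod [seq onePlusX j.*2.+1 | j <- iota 0 k].
Definition inv_poch_q (k : nat) : ps := psprod [seq geomX j.*2.+1 | j <- iota 0 k.+1].

Definition Bterm (k : nat) : ps := psmul (psX k) (psmul (poch_mq k) (inv_poch_q k)).

(* b(n): the summands with k > n are O(q^(n+1)), so only k <= n contribute *)
Definition b (n : nat) : int := \sum_(k < n.+1) Bterm k n.

(* f_m truncated: prod_{k=1}^{N} (1 - q^(m k)); the omitted factors are
   1 + O(q^(N+1)), so coefficients up to q^N are exact. *)
Definition f_trunc (m N : nat) : ps := psprod [seq oneMinusX (m * k) | k <- iota 1 N].

Definition a (n : nat) : int :=
  psprod [:: f_trunc 1 n; f_trunc 1 n; f_trunc 1 n; f_trunc 1 n; f_trunc 2 n] n.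

Definition sq_part (N : nat) : nat :=
  (\prod_(p <- primes N | (2 <= logn p N)%N) p ^ logn p N)%N.

(* Main.v *)
(** Write E(q) = sum b(2n) q^n, phi = f_1^2 / f_2 = sum (-1)^n q^(n^2) and
    psi = f_2^2 / f_1 = sum_(n >= 0) q^(n(n+1)/2).

    The series B(q) + B(-q) is bilateral, and Ramanujan's 1psi1 summation gives
    E phi = psi^2.  Since phi^4 = 1 mod 8 and f_1^4 f_2 = phi^3 psi^2, it follows
    that b(2k) = a(k) mod 8.  In the 3-dissections phi = f - 2 q W and
    psi = A + q g one has W A = f g, so the terms of exponent 2 mod 3 of
    E (f^3 - 8 q^3 W^3) = psi^2 (f^2 + 2 q f W + 4 q^2 W^2) add up to
    (4 + 4 + 1) q^2 (f g)^2; hence 9 divides b(2k) when k = 2 mod 3.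

    From phi(+-q) = phi(-q^4) -+ 2 q psi(q^8) and psi(q)^2 = phi(-q) psi(q^2) one
    gets f_1^4 f_2 = psi(q^2) (1 - 4 q psi(q^8)) mod 8.  So for even m, a(m) is
    mod 8 the indicator of 4m+1 being a square; for odd m it is -2 D(4m+1), where
    D(N) is the sum over d | N of the nontrivial character mod 4, because
    psi^2 = sum D(4m+1) q^m (again 1psi1).  Both conditions pass from 4m+1 to
    9 n^2 (4m+1): D is multiplicative, D(9N) = D(N), and D(p^(e+2j)) is an integer
    multiple of D(p^e) when e <= 1. *)
Require Import Defs.
From HB Require Import structures.
From mathcomp Require Import all_boot all_order all_algebra.
From mathcomp Require Import boolp.
From mathcomp Require Import ring zify.

Set Implicit Arguments. Unset Strict Implicit. Unset Printing Implicit Defensive.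
Import GRing.Theory Num.Theory.
Local Open Scope ring_scope.

(** * Formal power series *)

(** A separate type on which the Cauchy product can be declared as the ring multiplication, [ps]
    being a bare function type. *)
Record fps := Fps { coef : ps }.

HB.instance Definition _ := gen_eqMixin fps.
HB.instance Definition _ := gen_choiceMixin fps.

Lemma fpsP (f g : fps) : coef f =1 coef g -> f = g.
Proof. by case: f => f; case: g => g /= e; congr Fps; apply: funext. Qed.

Definition fps_add (f g : fps) := Fps (fun n => coef f n + coef g n).
Definition fps_opp (f : fps) := Fps (fun n => - coef f n).
Definition fps_mul (f g : fps) := Fps (psmul (coef f) (coef g)).

Fact fps_addA : associative fps_add.
Proof. by move=> f g h; apply: fpsP => n /=; rewrite addrA. Qed.
Fact fps_addC : commutative fps_add.
Proof. by move=> f g; apply: fpsP => n /=; rewrite addrC. Qed.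
Fact fps_add0 : left_id (Fps (fun=> 0)) fps_add.
Proof. by move=> f; apply: fpsP => n /=; rewrite add0r. Qed.
Fact fps_addN : left_inverse (Fps (fun=> 0)) fps_opp fps_add.
Proof. by move=> f; apply: fpsP => n /=; rewrite addNr. Qed.

HB.instance Definition _ :=
  GRing.isZmodule.Build fps fps_addA fps_addC fps_add0 fps_addN.

Definition trunc (N : nat) (f : ps) : {poly int} := \poly_(i < N) f i.

(** A coefficient of a product sees only finitely many coefficients of the factors, so associativity
    and commutativity are inherited from polynomials. *)
Lemma psmul_trunc N (f g : ps) n :
  (n < N)%N -> psmul f g n = (trunc N f * trunc N g)`_n.
Proof.
move=> ltnN; rewrite coefM; apply: eq_bigr => i _.
have le_i := ltn_ord i.
by rewrite !coef_poly !ifT //; lia.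
Qed.

Fact fps_mulA : associative fps_mul.
Proof.
move=> f g h; apply: fpsP => n /=.
rewrite !(psmul_trunc _ _ (ltnSn n)).
have cong (p q r : {poly int}) : (forall i, (i <= n)%N -> p`_i = q`_i) ->
    (p * r)`_n = (q * r)`_n.
  by move=> e; rewrite !coefM; apply: eq_bigr => i _; rewrite e // -ltnS.
have tr (u v : ps) i : (i <= n)%N ->
    (trunc n.+1 (psmul u v))`_i = (trunc n.+1 u * trunc n.+1 v)`_i.
  by move=> le_in; rewrite coef_poly ltnS le_in; apply: psmul_trunc.
rewrite mulrC (cong _ _ _ (tr (coef g) (coef h))) (cong _ _ _ (tr (coef f) (coef g))).
by rewrite mulrC mulrA.
Qed.

Fact fps_mulC : commutative fps_mul.
Proof. by move=> f g; apply: fpsP => n /=; rewrite !(psmul_trunc _ _ (ltnSn n)) mulrC. Qed.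

Fact fps_mul1 : left_id (Fps ps1) fps_mul.
Proof.
move=> f; apply: fpsP => n /=; rewrite /psmul big_ord_recl big1 => [|i _].
  by rewrite /ps1 mul1r addr0 subn0.
by rewrite /ps1 /= mul0r.
Qed.

Fact fps_mulD : left_distributive fps_mul fps_add.
Proof.
move=> f g h; apply: fpsP => n /=.
by rewrite /psmul -big_split; apply: eq_bigr => i _; rewrite /= mulrDl.
Qed.

Fact fps_1_neq0 : Fps ps1 != 0.
Proof. by apply/eqP => -[] /(congr1 (@^~ 0%N)). Qed.

HB.instance Definition _ := GRing.Zmodule_isComNzRing.Build fps
  fps_mulA fps_mulC fps_mul1 fps_mulD fps_1_neq0.

Lemma coefD f g n : coef (f + g) n = coef f n + coef g n. Proof. by []. Qed.
Lemma coefN f n : coef (- f) n = - coef f n. Proof. by []. Qed.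
Lemma coefB f g n : coef (f - g) n = coef f n - coef g n. Proof. by []. Qed.
Lemma coefM f g n :
  coef (f * g) n = \sum_(i < n.+1) coef f i * coef g (n - i)%N.
Proof. by []. Qed.
Lemma coefMn f k n : coef (f *+ k) n = coef f n *+ k.
Proof. by elim: k => // k IH; rewrite !mulrS coefD IH. Qed.
Lemma coefMnat f k n : coef (k%:R * f) n = k%:R * coef f n.
Proof. by rewrite mulr_natl coefMn mulr_natl. Qed.

Lemma coef_sum (I : Type) (r : seq I) (P : pred I) (F : I -> fps) n :
  coef (\sum_(i <- r | P i) F i) n = \sum_(i <- r | P i) coef (F i) n.
Proof. exact: (big_morph (fun f : fps => coef f n)). Qed.

(** * Limits, infinite sums and products *)

(** Divisibility by q^N, that is, the basic neighbourhoods of 0 for q-adic limits. *)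
Definition ord N (f : fps) := forall n, (n < N)%N -> coef f n = 0.

Lemma fps_eq f g : (forall N, ord N (f - g)) -> f = g.
Proof.
move=> h; apply: fpsP => n; apply/eqP; rewrite -subr_eq0 -coefB.
by apply/eqP; apply: (h n.+1).
Qed.

Lemma ord_ge0 f : ord 0 f. Proof. by []. Qed.
Lemma ordW M N f : (M <= N)%N -> ord N f -> ord M f.
Proof. by move=> leMN h n ltn; apply: h; lia. Qed.
Lemma ord0 N : ord N 0. Proof. by []. Qed.
Lemma ordD N f g : ord N f -> ord N g -> ord N (f + g).
Proof. by move=> hf hg n h; rewrite coefD hf // hg. Qed.
Lemma ordN N f : ord N f -> ord N (- f).
Proof. by move=> hf n h; rewrite coefN hf // oppr0. Qed.
Lemma ordB N f g : ord N f -> ord N g -> ord N (f - g).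
Proof. by move=> hf hg; apply/ordD/ordN. Qed.
Lemma ordM M N f g : ord M f -> ord N g -> ord (M + N) (f * g).
Proof.
move=> hf hg n lt_n; rewrite coefM big1 // => i _.
have [lt_i|le_i] := ltnP i M; first by rewrite hf ?mul0r.
have ? := ltn_ord i; by rewrite hg ?mulr0 //; lia.
Qed.
Lemma ordMl N f g : ord N g -> ord N (f * g).
Proof. exact: (ordM (ord_ge0 f)). Qed.
Lemma ordMr N f g : ord N f -> ord N (f * g).
Proof. by rewrite mulrC; apply: ordMl. Qed.
Lemma ordX k n f : ord k f -> ord (n * k) (f ^+ n).
Proof.
by move=> hf; elim: n => // n IH; rewrite exprS mulSn; apply: ordM.
Qed.
Lemma ordX1 n f : ord 1 f -> ord n (f ^+ n).
Proof. by move=> h; rewrite -[n in ord n]muln1; apply: ordX. Qed.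
Lemma ord_sum N (I : Type) (r : seq I) (P : pred I) (F : I -> fps) :
  (forall i, P i -> ord N (F i)) -> ord N (\sum_(i <- r | P i) F i).
Proof. by apply: big_ind; [apply: ord0|move=> ? ?; apply: ordD]. Qed.

Definition eqm N f g := ord N (f - g).

Lemma eqmxx N f : eqm N f f. Proof. by rewrite /eqm subrr. Qed.
Lemma eqm_sym N f g : eqm N f g -> eqm N g f.
Proof. by rewrite /eqm => /ordN; rewrite opprB. Qed.
Lemma eqm_trans N g f h : eqm N f g -> eqm N g h -> eqm N f h.
Proof. by rewrite /eqm => h1 h2; have := ordD h1 h2; rewrite addrA subrK. Qed.
Lemma eqmD N f f' g g' : eqm N f f' -> eqm N g g' -> eqm N (f + g) (f' + g').
Proof. by rewrite /eqm opprD addrACA; apply: ordD. Qed.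
Lemma eqmM N f f' g g' : eqm N f f' -> eqm N g g' -> eqm N (f * g) (f' * g').
Proof.
rewrite /eqm => h1 h2.
have -> : f * g - f' * g' = (f - f') * g + f' * (g - g') by ring.
by apply: ordD; [apply: ordMr|apply: ordMl].
Qed.
Lemma eqm_prod N (I : Type) (r : seq I) (F G : I -> fps) :
  (forall i, eqm N (F i) (G i)) ->
  eqm N (\prod_(i <- r) F i) (\prod_(i <- r) G i).
Proof.
by move=> h; apply: big_ind2; [apply: eqmxx|move=> *; apply: eqmM|move=> *].
Qed.
Lemma eqm_coef N f g n : eqm N f g -> (n < N)%N -> coef f n = coef g n.
Proof. by move=> h /h; rewrite coefB => /eqP; rewrite subr_eq0 => /eqP. Qed.
Lemma coef_eqm N f g : (forall n, (n < N)%N -> coef f n = coef g n) -> eqm N f g.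
Proof. by move=> h n /h e; rewrite coefB e subrr. Qed.

(* The sum of a family with [ord n (g n)]; for other families the value is
   meaningless. *)
Definition isum (g : nat -> fps) := Fps (fun N => \sum_(n < N.+1) coef (g n) N).

Definition fam (g : nat -> fps) := forall n, ord n (g n).

Lemma coef_isum g N : coef (isum g) N = \sum_(n < N.+1) coef (g n) N.
Proof. by []. Qed.

Lemma eq_isum g h : g =1 h -> isum g = isum h.
Proof. by move=> e; apply: fpsP => N; apply: eq_bigr => i _; rewrite e. Qed.

Lemma isum_part g N M : fam g -> (N <= M)%N -> eqm N (isum g) (\sum_(n < M) g n).
Proof.
move=> hg leNM; apply: coef_eqm => i lt_i.
rewrite coef_sum coef_isum (big_ord_widen M (fun n => coef (g n) i)); last lia.
rewrite [RHS](bigID (fun n : 'I_M => n < i.+1)%N) /= [X in _ + X]big1 ?addr0 //.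
by move=> n h; apply: hg; lia.
Qed.

Lemma isum_uniq g f : fam g ->
  (forall N, exists2 M, (N <= M)%N & eqm N f (\sum_(n < M) g n)) -> f = isum g.
Proof.
move=> hg h; apply: fps_eq => N; have [M leNM e] := h N.
by apply: eqm_trans e _; apply/eqm_sym/isum_part.
Qed.

Lemma isum_eqm N g h : (forall n, eqm N (g n) (h n)) -> eqm N (isum g) (isum h).
Proof.
move=> e; apply: coef_eqm => i lt_i; apply: eq_bigr => n _.
exact: eqm_coef (e n) lt_i.
Qed.

Lemma isumD g h : isum g + isum h = isum (fun n => g n + h n).
Proof. by apply: fpsP => N; rewrite coefD !coef_isum -big_split. Qed.

Lemma isumN g : - isum g = isum (fun n => - g n).
Proof. by apply: fpsP => N; rewrite coefN !coef_isum -sumrN. Qed.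

Lemma isumMl f g : fam g -> f * isum g = isum (fun n => f * g n).
Proof.
move=> hg; apply: isum_uniq => [n|N]; first exact/ordMl/hg.
by exists N => //; rewrite -mulr_sumr; apply/eqmM/isum_part => //; apply: eqmxx.
Qed.

Lemma famS g : fam g -> fam (g \o S).
Proof. by move=> hg n; apply: ordW (hg n.+1). Qed.

Lemma isum_rec g : fam g -> isum g = g 0%N + isum (g \o S).
Proof.
move=> hg; apply/esym/isum_uniq => // N; exists N.+1 => //.
rewrite big_ord_recl; apply: eqmD; first exact: eqmxx.
by apply: isum_part => //; apply: famS.
Qed.

Lemma big_ord_mul (V : nmodType) (k M : nat) (g : nat -> V) :
  \sum_(n < k * M) g n = \sum_(m < M) \sum_(j < k) g (k * m + j)%N.
Proof.
elim: M => [|M IH]; first by rewrite muln0 !big_ord0.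
by rewrite big_ord_recr -IH mulnSr big_split_ord.
Qed.

Lemma isum_mul k g : (0 < k)%N -> fam g ->
  isum g = isum (fun m => \sum_(j < k) g (k * m + j)%N).
Proof.
move=> k0 hg; apply: isum_uniq => [n|N].
  by apply: ord_sum => j _; apply: ordW (hg _); nia.
by exists N => //; rewrite -big_ord_mul; apply: isum_part => //; nia.
Qed.

(** The inverse of [1 - x] when [x] has no constant term; denominators are expressed through it. *)
Definition geo (x : fps) := isum (fun n => x ^+ n).

Lemma geoP x : ord 1 x -> (1 - x) * geo x = 1.
Proof.
move=> hx; have hf : fam (fun n => x ^+ n) by move=> n; apply: ordX1.
have e : geo x = 1 + x * geo x.
  rewrite {1}/geo isum_rec // expr0 isumMl //.
  by congr (_ + _); apply: eq_isum => n; rewrite /= exprS.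
by rewrite mulrBl mul1r {1}e addrK.
Qed.

(** The constant term of [f] is 1, so [f] is invertible with inverse [geo (1 - f)]. *)
Lemma fps_mulI f g h : ord 1 (1 - f) -> f * g = f * h -> g = h.
Proof.
move=> /geoP; rewrite subKr mulrC => e1 e.
by rewrite -[g]mul1r -[h]mul1r -e1 -!mulrA e.
Qed.

Lemma geo_uniq x g : ord 1 x -> (1 - x) * g = 1 -> g = geo x.
Proof.
by move=> hx e; apply: (@fps_mulI (1 - x)); rewrite ?subKr // e geoP.
Qed.

Lemma eqm_geo N x y : ord 1 x -> ord 1 y -> eqm N x y -> eqm N (geo x) (geo y).
Proof.
move=> hx hy h; rewrite /eqm.
have -> : geo x - geo y = (x - y) * (geo x * geo y).
  by rewrite -[geo x in LHS]mulr1 -[geo y in LHS]mulr1 -{1}(geoP hy) -{2}(geoP hx); ring.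
exact: ordMr.
Qed.

Lemma geo0 : geo 0 = 1.
Proof. by apply/esym/geo_uniq => //; rewrite subr0 mulr1. Qed.

Definition poch (x p : fps) n : fps := \prod_(i < n) (1 - x * p ^+ i).
(** The infinite product (x; p)_∞. When [p] has no constant term, the factors from index N+1 on are
    1 modulo q^(N+1), so N+1 factors determine the coefficient of index N. *)
Definition pinf (x p : fps) := Fps (fun N => coef (poch x p N.+1) N).

Lemma poch0 x p : poch x p 0 = 1. Proof. exact: big_ord0. Qed.
Lemma pochS x p n : poch x p n.+1 = poch x p n * (1 - x * p ^+ n).
Proof. exact: big_ord_recr. Qed.
Lemma pochSl x p n : poch x p n.+1 = (1 - x) * poch (x * p) p n.
Proof.
rewrite /poch big_ord_recl expr0 mulr1; congr (_ * _).
by apply: eq_bigr => i _; rewrite exprS mulrA.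
Qed.

Lemma eqm_poch x p m n : ord 1 p -> (m <= n)%N -> eqm m (poch x p n) (poch x p m).
Proof.
move=> hp; elim: n => [|n IH]; first by rewrite leqn0 => /eqP ->; apply: eqmxx.
rewrite leq_eqVlt => /predU1P[->|lt_mn]; first exact: eqmxx.
apply: eqm_trans (IH lt_mn); rewrite /eqm pochS mulrBr mulr1 addrAC subrr add0r.
apply: ordN; apply: ordMl; apply: ordMl; exact: (@ordW m n _ lt_mn (ordX1 hp)).
Qed.

Lemma pinfP x p m n : ord 1 p -> (m <= n)%N -> eqm m (pinf x p) (poch x p n).
Proof.
move=> hp le_mn; apply: coef_eqm => i lt_i /=.
by apply: eqm_coef (ltnSn i); apply/eqm_sym/eqm_poch => //; lia.
Qed.

Lemma pinf_uniq x p f : ord 1 p ->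
  (forall m, exists2 n, (m <= n)%N & eqm m f (poch x p n)) -> f = pinf x p.
Proof.
move=> hp h; apply: fps_eq => N; have [n le_n e] := h N.
by apply: eqm_trans e _; apply/eqm_sym/pinfP.
Qed.

Lemma pinf0 p : ord 1 p -> pinf 0 p = 1.
Proof.
move=> hp; apply/esym/pinf_uniq => // m; exists m => //.
by rewrite /poch big1 => [|i _]; rewrite ?mul0r ?subr0 //; apply: eqmxx.
Qed.

Lemma pinf_rec x p : ord 1 p -> pinf x p = (1 - x) * pinf (x * p) p.
Proof.
move=> hp; apply/esym/pinf_uniq => // m; exists m.+1 => //.
by rewrite pochSl; apply/eqmM/pinfP => //; apply: eqmxx.
Qed.

Lemma pinf_unit x p : ord 1 x -> ord 1 p -> ord 1 (1 - pinf x p).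
Proof.
move=> hx hp; apply/eqm_sym; apply: eqm_trans (pinfP _ hp (leqnn 1)) _.
rewrite /eqm pochS poch0 mul1r mulr1 addrAC subrr add0r; exact/ordN.
Qed.

Lemma pinf_split2 x p : ord 1 p ->
  pinf x p = pinf x (p ^+ 2) * pinf (x * p) (p ^+ 2).
Proof.
move=> hp; have hp2 : ord 1 (p ^+ 2) by rewrite expr2; apply: ordMl.
apply/esym/pinf_uniq => // m; exists (2 * m)%N; first lia.
have -> : poch x p (2 * m) = poch x (p ^+ 2) m * poch (x * p) (p ^+ 2) m.
  elim: m => [|m IH]; first by rewrite muln0 !poch0 mulr1.
  rewrite mulnSr addn2 !pochS IH (exprS p (2 * m)) exprM.
    by move: (_ ^+ m) => u; ring.
by apply: eqmM; apply: pinfP.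
Qed.

Lemma pinf_split3 x p : ord 1 p ->
  pinf x p = pinf x (p ^+ 3) * pinf (x * p) (p ^+ 3) * pinf (x * p ^+ 2) (p ^+ 3).
Proof.
move=> hp; have hp3 : ord 1 (p ^+ 3) by rewrite exprS; apply: ordMr.
apply/esym/pinf_uniq => // m; exists (3 * m)%N; first lia.
have -> : poch x p (3 * m) =
    poch x (p ^+ 3) m * poch (x * p) (p ^+ 3) m * poch (x * p ^+ 2) (p ^+ 3) m.
  elim: m => [|m IH]; first by rewrite muln0 !poch0 !mulr1.
  rewrite mulnSr addn3 !pochS IH (exprS p (3 * m).+1) (exprS p (3 * m)) exprM.
    by move: ((p ^+ 3) ^+ m) => u; ring.
by apply: eqmM; [apply: eqmM|]; apply: pinfP.
Qed.

Lemma pinfN x p : ord 1 p -> pinf x p * pinf (- x) p = pinf (x ^+ 2) (p ^+ 2).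
Proof.
move=> hp; have hp2 : ord 1 (p ^+ 2) by rewrite expr2; apply: ordMl.
apply: pinf_uniq => // m; exists m => //.
have -> : poch (x ^+ 2) (p ^+ 2) m = poch x p m * poch (- x) p m.
  elim: m => [|m IH]; first by rewrite !poch0 mulr1.
  rewrite !pochS IH exprAC.
    by move: (p ^+ m) => u; ring.
by apply: eqmM; apply: pinfP.
Qed.

(** * Ramanujan's 1psi1 summation and the Jacobi triple product *)

(* Ramanujan's 1psi1 sum is taken in the symmetric form
   [sum_n prod_(i < n) (z - c p^i) / (1 - c y p^i)
     + sum_n prod_(i <= n) (y - d p^i) / (1 - d z p^i)]  with [p = c d];
   it is invariant under the exchange of (c, z) and (d, y).
   In the usual notation p is the base, [a = c / z] and [b = c y]. *)
Definition half11 (p c y z : fps) n : fps :=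
  \prod_(i < n) ((z - c * p ^+ i) * geo (c * y * p ^+ i)).

Definition psi11 (p c d y z : fps) : fps :=
  1 + isum (fun n => half11 p c y z n.+1 + half11 p d z y n.+1).

Lemma psi11C p c d y z : psi11 p c d y z = psi11 p d c z y.
Proof. by congr (_ + _); apply: eq_isum => n; rewrite addrC. Qed.

Lemma half0 p c y z : half11 p c y z 0 = 1. Proof. exact: big_ord0. Qed.

Lemma halfS p c y z n :
  half11 p c y z n.+1 = half11 p c y z n * ((z - c * p ^+ n) * geo (c * y * p ^+ n)).
Proof. exact: big_ord_recr. Qed.

(** The first factor [z - c] may have a nonzero constant term, as for [c = -1]; hence n+1 factors
    guarantee only order n. *)
Lemma fam_half p c y z : ord 1 p -> ord 1 z -> fam (fun n => half11 p c y z n.+1).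
Proof.
move=> hp hz; elim=> // n IH; rewrite halfS -[X in ord X](addn1 n); apply: ordM => //.
by apply: ordMr; apply: ordB => //; apply: ordMl; rewrite exprS; apply: ordMr.
Qed.

Lemma half_shift p c y z n :
  half11 p c (y * p) z n * geo (c * y) = half11 p c y z n * geo (c * y * p ^+ n).
Proof.
elim: n => [|n IH]; first by rewrite !half0 expr0 mulr1.
have e : c * (y * p) * p ^+ n = c * y * p ^+ n.+1 by rewrite exprS; ring.
by rewrite !halfS e mulrAC IH; ring.
Qed.

(** Over the common denominator 1 - c y p^n the numerator is 1 - c y p^n - y (z - c p^n) = 1 - y z,
    which does not depend on n. *)
Lemma half_step p c y z n : ord 1 p -> ord 1 y ->
  half11 p c y z n - y * half11 p c y z n.+1 =
  (1 - y * z) * geo (c * y) * half11 p c (y * p) z n.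
Proof.
move=> hp hy; rewrite -mulrA (mulrC (geo _)) half_shift halfS.
have := @geoP (c * y * p ^+ n) (ordMr _ (ordMl _ hy)).
move: (p ^+ n : fps) => u; move: (geo _) => G; move: (half11 _ _ _ _ _) => H e.
have -> : H - y * (H * ((z - c * u) * G)) = H * (1 - y * (z - c * u) * G) by ring.
by rewrite -{1}e; ring.
Qed.

Lemma half_shift' p d y z n :
  half11 p d z (y * p) n.+1 =
  half11 p d z y n * ((y * p - d) * p ^+ n * geo (d * z * p ^+ n)).
Proof.
elim: n => [|n IH]; first by rewrite halfS !half0 expr0 !mulr1.
by rewrite halfS IH halfS !exprS; ring.
Qed.

(** The companion relation for the other half. Here [p = c * d] enters, through y p - d = -d (1 - c
    y), which cancels [geo (c * y)]. *)
Lemma half_step' p c d y z n : p = c * d -> ord 1 y -> ord 1 z ->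
  half11 p d z y n.+1 - y * half11 p d z y n =
  (1 - y * z) * geo (c * y) * half11 p d z (y * p) n.+1.
Proof.
move=> ep hy hz; rewrite half_shift' halfS.
have := @geoP (d * z * p ^+ n) (ordMr _ (ordMl _ hz)).
have := @geoP (c * y) (ordMl _ hy).
move: (p ^+ n : fps) => u; move: (half11 _ _ _ _ _) => H.
move: (geo (c * y)) => K eK; move: (geo _) => G eG.
have -> : H * ((y - d * u) * G) - y * H =
    H * ((y - d * u) * G - y * ((1 - d * z * u) * G)) by rewrite eG; ring.
rewrite ep.
transitivity (- ((1 - c * y) * K) * (1 - y * z) * H * d * u * G); last by ring.
by rewrite eK; ring.
Qed.

(** Summing the two contiguous relations over the bilateral series gives a functional equation under
    y -> y p. *)
Lemma psi11_rec p c d y z : p = c * d -> ord 1 p -> ord 1 y -> ord 1 z ->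
  (1 - y) * (1 - c * y) * psi11 p c d y z = (1 - y * z) * psi11 p c d (y * p) z.
Proof.
move=> ep hp hy hz.
have hyp : ord 1 (y * p) by apply: ordMl.
suff e : (1 - y) * psi11 p c d y z =
    (1 - y * z) * geo (c * y) * psi11 p c d (y * p) z.
  rewrite mulrAC e -[RHS]mulr1; transitivity ((1 - y * z) *
    psi11 p c d (y * p) z * ((1 - c * y) * geo (c * y))); first by ring.
  by rewrite geoP //; apply: ordMl.
have fs := fam_half c y hp hz; have ft := fam_half d z hp hy.
have fs' := fam_half c (y * p) hp hz; have ft' := fam_half d z hp hyp.
rewrite /psi11 -!isumD !mulrDr mulr1.
(* The instance n = 0 supplies the isolated term 1 of the series on the right. *)
have e0 := half_step c z 0 hp hy; rewrite !half0 mulr1 in e0.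
rewrite -{1}e0 (isumMl _ fs') (isumMl _ ft').
rewrite -(eq_isum (fun n => half_step c z n.+1 hp hy)).
rewrite -(eq_isum (fun n => half_step' n ep hy hz)).
rewrite -!isumD -!isumN.
have -> : isum (fun n => y * half11 p d z y n) = y + y * isum (fun n => half11 p d z y n.+1).
  rewrite isum_rec ?half0 ?mulr1 ?isumMl // => -[|n] //=.
  by rewrite -add1n; apply: ordM.
have -> : isum (fun n => y * half11 p c y z n.+2) =
    isum (fun n => y * half11 p c y z n.+1) - y * half11 p c y z 1.
  have /isum_rec -> : fam (fun n => y * half11 p c y z n.+1).
    by move=> n; apply/ordMl/fs.
  by rewrite addrC addKr.
rewrite -(isumMl y fs); ring.
Qed.

Lemma psi11_recs p c d y z n : p = c * d -> ord 1 p -> ord 1 y -> ord 1 z ->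
  poch y p n * poch (c * y) p n * psi11 p c d y z =
  poch (y * z) p n * psi11 p c d (y * p ^+ n) z.
Proof.
move=> ep hp hy hz; elim: n => [|n IH]; first by rewrite !poch0 expr0 !mulr1.
have hyn : ord 1 (y * p ^+ n) by apply: ordMr.
have := psi11_rec ep hp hyn hz.
have -> : y * p ^+ n * p = y * p ^+ n.+1 by rewrite exprSr mulrA.
rewrite !pochS !mulrA => e.
transitivity (poch y p n * poch (c * y) p n * psi11 p c d y z *
   ((1 - y * p ^+ n) * (1 - c * y * p ^+ n))); first by ring.
rewrite IH.
transitivity (poch (y * z) p n * ((1 - y * p ^+ n) * (1 - c * y * p ^+ n) *
   psi11 p c d (y * p ^+ n) z)); first by ring.
by rewrite e (mulrAC y); ring.
Qed.

Lemma eqm_half N p c y y' z z' n : ord 1 p -> ord 1 y -> ord 1 y' ->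
  eqm N y y' -> eqm N z z' -> eqm N (half11 p c y z n) (half11 p c y' z' n).
Proof.
move=> hp hy hy' ey ez; apply: eqm_prod => i.
apply: eqmM; first by apply: eqmD => //; apply: eqmxx.
apply: eqm_geo; try by apply/ordMr/ordMl.
by apply: eqmM; [apply: eqmM|] => //; apply: eqmxx.
Qed.

(** The limit of [psi11_recs]: y p^n tends to 0 q-adically. *)
Lemma psi11_pinf1 p c d y z : p = c * d -> ord 1 p -> ord 1 y -> ord 1 z ->
  pinf y p * pinf (c * y) p * psi11 p c d y z = pinf (y * z) p * psi11 p c d 0 z.
Proof.
move=> ep hp hy hz; apply: fps_eq => N; rewrite -/(eqm N _ _).
have e x := pinfP x hp (leqnn N).
apply: (@eqm_trans _ (poch y p N * poch (c * y) p N * psi11 p c d y z)).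
  by do 2?apply: eqmM => //; apply: eqmxx.
rewrite psi11_recs //; apply: eqmM; first exact: eqm_sym.
have hyN : ord N (y * p ^+ N) by apply/ordMl/ordX1.
have hy1 : ord 1 (y * p ^+ N) by apply: ordMr.
have e0 : eqm N (y * p ^+ N) 0 by rewrite /eqm subr0.
apply: eqmD; first exact: eqmxx.
by apply: isum_eqm => n; apply: eqmD; apply: eqm_half => //; apply: eqmxx.
Qed.

(** For p = c d this is Ramanujan's f(-c, -d), the sum over all integers n of (-c)^n p^(n(n-1)/2);
    the terms of negative index are written with [d]. *)
Definition theta (p c d : fps) : fps :=
  1 + isum (fun n => (- c) ^+ n.+1 * p ^+ 'C(n.+1, 2) + (- d) ^+ n.+1 * p ^+ 'C(n.+1, 2)).

Lemma half00 p c n : half11 p c 0 0 n = (- c) ^+ n * p ^+ 'C(n, 2).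
Proof.
elim: n => [|n IH]; first by rewrite half0 !expr0 mulr1.
by rewrite halfS IH mulr0 mul0r geo0 binS bin1 exprS exprD; ring.
Qed.

(** Send y to 0, then z to 0 by the symmetry [psi11C]; what is left is the theta series, by
    [half00]. *)
Lemma psi11_pinf_theta p c d y z : p = c * d -> ord 1 p -> ord 1 y -> ord 1 z ->
  pinf y p * pinf (c * y) p * pinf z p * pinf (d * z) p * psi11 p c d y z =
  pinf (y * z) p * theta p c d.
Proof.
move=> ep hp hy hz.
have e1 := psi11_pinf1 ep hp hy hz.
have ep' : p = d * c by rewrite mulrC.
have e2 := psi11_pinf1 ep' hp hz (@ord0 1).
have -> : theta p c d = psi11 p d c 0 0.
  by rewrite psi11C; congr (_ + _); apply: eq_isum => n; rewrite !half00.
rewrite mulr0 (pinf0 hp) mul1r (psi11C p d c z) in e2.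
by rewrite -e2 mulrCA -e1; ring.
Qed.

(* At y = d p, z = c p all but the first terms of the 1psi1 series vanish. *)
Lemma jacobi_triple (p c d : fps) : p = c * d -> ord 1 p ->
  theta p c d = pinf c p * pinf d p * pinf p p.
Proof.
move=> ep hp.
have hc : ord 1 (c * p) by apply: ordMl.
have hd : ord 1 (d * p) by apply: ordMl.
have := psi11_pinf_theta ep hp hd hc.
have v x w n : half11 p x w (x * p) n.+2 = 0.
  elim: n => [|n IH]; last by rewrite halfS IH mul0r.
  by rewrite halfS expr1 subrr mul0r mulr0.
have -> : psi11 p c d (d * p) (c * p) = 1 - (c + d) * (1 - p) * geo (p ^+ 2).
  congr (_ + _); rewrite isum_rec => [|n]; last first.
    by apply: ordD; apply: fam_half.
  rewrite [X in _ + X](_ : _ = 0) ?addr0.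
    rewrite !halfS !half0 expr0 !mulr1 !mul1r !mulrA (mulrC d c) -ep -expr2; ring.
  by apply: fpsP => n; rewrite coef_isum big1 // => i _ /=; rewrite !v addr0.
have hp2 : ord 1 (p ^+ 2) by rewrite expr2; apply: ordMl.
have -> : d * p * (c * p) = p ^+ 2 * p by rewrite ep; ring.
have -> : c * (d * p) = p ^+ 2 by rewrite ep; ring.
have -> : d * (c * p) = p ^+ 2 by rewrite ep; ring.
rewrite (pinf_rec c hp) (pinf_rec d hp) (pinf_rec p hp) -expr2 (pinf_rec (p ^+ 2) hp).
have := pinf_unit (ordMr p hp2) hp.
move: (pinf (c * p) p) (pinf (d * p) p) (pinf (p ^+ 2 * p) p) => A C P hP.
have := geoP hp2; move: (geo _) => G eG e.
apply: (fps_mulI hP); rewrite -e.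
(* The numerator becomes (1 - p)(1 + p - c - d), and 1 + p - c - d = (1 - c)(1 - d) because p = c
   d. *)
have -> : 1 - (c + d) * (1 - p) * G =
    ((1 - p ^+ 2) - (c + d) * (1 - p)) * G by rewrite mulrBl eG.
transitivity (C * P * A * P * (1 - p) * (1 + c * d - c - d) * (1 - p ^+ 2) *
    ((1 - p ^+ 2) * G)).
  by rewrite -ep; ring.
by rewrite eG; ring.
Qed.

(** * The theta functions phi and psi *)

Lemma fps_mulnI k (f g : fps) : (0 < k)%N -> k%:R * f = k%:R * g -> f = g.
Proof.
move=> k0 e; apply: fpsP => n; move/(congr1 (fun h => coef h n)): e.
by rewrite !coefMnat; apply: mulfI; rewrite pnatr_eq0 -lt0n.
Qed.

Lemma ordX_gt0 k (x : fps) : (0 < k)%N -> ord 1 x -> ord 1 (x ^+ k).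
Proof. by case: k => // k _ hx; rewrite exprS; apply: ordMr. Qed.

(** In the classical notation, where all signs are positive, this is phi(-x). *)
Definition phi (x : fps) : fps := theta (x ^+ 2) x x.
Definition psi (x : fps) : fps := isum (fun n => x ^+ 'C(n.+1, 2)).

Lemma leq_bin2 n : (n <= 'C(n.+1, 2))%N.
Proof. by rewrite binS bin1 leq_addl. Qed.

Lemma fam_psi (x : fps) : ord 1 x -> fam (fun n => x ^+ 'C(n.+1, 2)).
Proof. by move=> hx n; apply: ordW (leq_bin2 n) (ordX1 hx). Qed.

(** As n runs over all integers, n(n-1)/2 takes each triangular value twice. *)
Lemma psi2_theta (x : fps) : ord 1 x -> 2 * psi x = theta x (- x) (- 1).
Proof.
move=> hx; rewrite /theta opprK (_ : 2 * _ = psi x + psi x); last by ring.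
rewrite {1}/psi isum_rec ?expr0 -?addrA; last exact: fam_psi.
congr (_ + _); rewrite isumD; apply: eq_isum => n.
by rewrite /= opprK expr1n mul1r -exprD [in LHS]binS bin1 addnC.
Qed.

Section Products.
Variables (x : fps).
Hypothesis hx : ord 1 x.
Let hx2 : ord 1 (x ^+ 2). Proof. exact: ordX_gt0. Qed.

Lemma pinf_odd_even : pinf x x = pinf x (x ^+ 2) * pinf (x ^+ 2) (x ^+ 2).
Proof. by rewrite (pinf_split2 x hx). Qed.

Lemma pinf_even : pinf x x * pinf (- x) x = pinf (x ^+ 2) (x ^+ 2).
Proof. exact: pinfN. Qed.

(** Euler's identity between partitions into distinct parts and into odd parts. *)
Lemma euler_odd_distinct : pinf (- x) x * pinf x (x ^+ 2) = 1.
Proof.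
apply: (@fps_mulI (pinf (x ^+ 2) (x ^+ 2))); first exact: pinf_unit.
by rewrite mulr1 -[RHS]pinf_even pinf_odd_even; ring.
Qed.

Lemma phi_pinf : phi x = pinf x (x ^+ 2) ^+ 2 * pinf (x ^+ 2) (x ^+ 2).
Proof. by rewrite /phi jacobi_triple // expr2. Qed.

Lemma psi_pinf : psi x = pinf (- x) x * pinf (x ^+ 2) (x ^+ 2).
Proof.
apply: (@fps_mulnI 2) => //; rewrite psi2_theta // jacobi_triple //; last by ring.
rewrite (pinf_rec (-1) hx) mulN1r -pinf_even; ring.
Qed.
End Products.


(** With u = (x; x^2)_∞, v = (x^2; x^2)_∞ and g = (-x; x)_∞, the products are f_1 = u v, f_2 = v,
    phi = u^2 v, psi = g v, and g u = 1. *)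
Lemma eta41_theta (x : fps) : ord 1 x ->
  pinf x x ^+ 4 * pinf (x ^+ 2) (x ^+ 2) = phi x ^+ 3 * psi x ^+ 2.
Proof.
move=> hx; rewrite phi_pinf // psi_pinf // pinf_odd_even //.
have := euler_odd_distinct hx.
move: (pinf (- x) x) (pinf x (x ^+ 2)) (pinf (x ^+ 2) (x ^+ 2)) => g u v e.
transitivity ((u ^+ 4 * v ^+ 5) * (g * u) ^+ 2); last by ring.
by rewrite e; ring.
Qed.

Lemma psi_sqr (x : fps) : ord 1 x -> psi x ^+ 2 = phi (- x) * psi (x ^+ 2).
Proof.
move=> hx; have hx2 : ord 1 (x ^+ 2) by apply: ordX_gt0.
rewrite phi_pinf; last exact: ordN.
rewrite !psi_pinf // sqrrN -(pinf_even hx2) (pinf_split2 (- x) hx) mulNr -expr2.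
ring.
Qed.

Lemma bin2_mul n : ('C(n, 2) * 2 = n * n.-1)%N.
Proof. by rewrite bin2 muln2 even_halfK // oddM; case: n => //= n; case: (odd n). Qed.

(** Separate even and odd n in the sum of (-1)^n x^(n^2): (2m)^2 = 4 m^2, and the odd squares are 1
    + 8 m(m+1)/2, each attained twice. *)
Lemma phi_split2 (x : fps) : ord 1 x ->
  phi x = phi (- x ^+ 4) - 2 * (x * psi (x ^+ 8)).
Proof.
move=> hx; have hx2 : ord 1 (x ^+ 2) by apply: ordX_gt0.
have hx4 : ord 1 (x ^+ 4) by apply: ordX_gt0.
have hx8 : ord 1 (x ^+ 8) by apply: ordX_gt0.
rewrite /phi /theta opprK sqrrN -exprM (@isum_mul 2) //; last first.
  move=> n; apply: ordD; apply: ordMr; rewrite exprS; apply: ordMl; apply: ordX1; exact: ordN.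
rewrite mulrA isumMl ?isumN; last exact: fam_psi.
rewrite -addrA isumD; congr (_ + _); apply: eq_isum => m.
rewrite !big_ord_recl big_ord0 addr0 /= /bump /=.
have e1 : ((2 * m + 0).+1 + 2 * 'C((2 * m + 0).+1, 2) = 1 + 8 * 'C(m.+1, 2))%N.
  by have := bin2_mul (2 * m + 0).+1; have := bin2_mul m.+1; nia.
have e2 : ((2 * m + 1).+1 + 2 * 'C((2 * m + 1).+1, 2) = 4 * m.+1 + 8 * 'C(m.+1, 2))%N.
  by have := bin2_mul (2 * m + 1).+1; have := bin2_mul m.+1; nia.
have E1 : x ^+ (2 * m + 0).+1 * (x ^+ 2) ^+ 'C((2 * m + 0).+1, 2) =
    x * (x ^+ 8) ^+ 'C(m.+1, 2).
  by rewrite -exprM -exprD e1 exprD expr1 exprM.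
have E2 : x ^+ (2 * m + 1).+1 * (x ^+ 2) ^+ 'C((2 * m + 1).+1, 2) =
    (x ^+ 4) ^+ m.+1 * (x ^+ (4 * 2)) ^+ 'C(m.+1, 2).
  by rewrite -!exprM -!exprD e2.
have sg n : (- x) ^+ n = (-1) ^+ odd n * x ^+ n by rewrite signr_odd; apply: exprNn.
have o1 : odd (2 * m + 0).+1 = true by lia.
have o2 : odd (2 * m + 1).+1 = false by lia.
by rewrite !sg o1 o2 expr0 expr1 !mul1r -!mulrA E1 E2; ring.
Qed.

(** * The generating functions of b and a *)

Definition q : fps := Fps (psX 1).

Lemma psXE k : Fps (psX k) = q ^+ k.
Proof.
elim: k => [|k IH]; first exact: fpsP.
rewrite exprS -IH; apply: fpsP => -[|n]; rewrite coefM big_ord_recl /= /psX /=.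
  by rewrite big_ord0 mul0r addr0.
rewrite mul0r add0r big_ord_recl big1 => [|i _]; last by rewrite mul0r.
by rewrite addr0 mul1r subSS subn0 eqSS.
Qed.

Lemma coefXn k n : coef (q ^+ k) n = (n == k)%:R.
Proof. by rewrite -psXE. Qed.

Lemma ord_q : ord 1 q. Proof. by case. Qed.

Lemma ord_qX k : (0 < k)%N -> ord 1 (q ^+ k).
Proof. by move=> k0; apply: ordX_gt0 => //; apply: ord_q. Qed.
#[local] Hint Resolve ord_q ord_qX : core.

Lemma onePlusXE k : Fps (onePlusX k) = 1 + q ^+ k.
Proof. by rewrite -psXE; apply: fpsP. Qed.

Lemma oneMinusXE k : Fps (oneMinusX k) = 1 - q ^+ k.
Proof. by rewrite -psXE; apply: fpsP. Qed.

Lemma coef_geo_qX k n : (0 < k)%N -> coef (geo (q ^+ k)) n = (k %| n)%:R.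
Proof.
move=> k0; rewrite coef_isum.
under eq_bigr do rewrite -exprM coefXn.
have [/dvdnP[j ->]|ndv] := boolP (k %| n)%N.
  have ltj : (j < (j * k).+1)%N by nia.
  rewrite (bigD1 (Ordinal ltj)) //= big1 => [|i /eqP ni].
    by rewrite (mulnC k j) eqxx addr0.
  rewrite (mulnC k i) eqn_pmul2r //; case: eqP => // e.
  by case: ni; apply: val_inj.
rewrite big1 // => i _; case: eqP => // e.
by case/dvdnP: ndv; exists i; rewrite mulnC.
Qed.

Lemma geomXE k : (0 < k)%N -> Fps (geomX k) = geo (q ^+ k).
Proof. by move=> k0; apply: fpsP => n; rewrite coef_geo_qX. Qed.

Lemma psprodE (I : Type) (s : seq I) (F : I -> ps) :
  Fps (psprod [seq F i | i <- s]) = \prod_(i <- s) Fps (F i).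
Proof. by elim: s => [|i s IH]; rewrite ?big_nil ?big_cons -?IH. Qed.

Lemma BtermE k : Fps (Bterm k) =
  q ^+ k * (\prod_(j < k) (1 + q ^+ j.*2.+1) *
            \prod_(j < k.+1) geo (q ^+ j.*2.+1)).
Proof.
rewrite -[LHS]/(Fps (psX k) * (Fps (poch_mq k) * Fps (inv_poch_q k))).
rewrite psXE /poch_mq /inv_poch_q !psprodE.
have iE n : iota 0 n = index_iota 0 n by rewrite /index_iota subn0.
rewrite !iE !big_mkord.
congr (_ * (_ * _)); apply: eq_bigr => i _; first exact: onePlusXE.
exact: geomXE.
Qed.

(** * The substitutions q -> -q and q -> q^2 *)

Definition neg f := Fps (fun n => (-1) ^+ n * coef f n).

Fact neg_is_additive : zmod_morphism neg.
Proof. by move=> f g; apply: fpsP => n; rewrite /= mulrBr. Qed.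

Fact neg_is_multiplicative : monoid_morphism neg.
Proof.
split=> [|f g]; apply: fpsP => n.
  by case: n => [|n]; rewrite /= /ps1 ?mul1r ?mulr0.
rewrite /= /psmul mulr_sumr; apply: eq_bigr => i _ /=.
by rewrite mulrACA -exprD subnKC // -ltnS.
Qed.

HB.instance Definition _ := GRing.isZmodMorphism.Build fps fps neg neg_is_additive.
HB.instance Definition _ :=
  GRing.isMonoidMorphism.Build fps fps neg neg_is_multiplicative.

Lemma neg_q : neg q = - q.
Proof.
by apply: fpsP => -[|[|n]]; rewrite /= /psX /= ?mulr0 ?oppr0 // expr1 mulr1.
Qed.

Lemma ord_neg N f : ord N f -> ord N (neg f).
Proof. by move=> h n /h /= ->; rewrite mulr0. Qed.

Lemma neg_geo x : ord 1 x -> neg (geo x) = geo (neg x).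
Proof.
move=> hx; apply: geo_uniq; first exact: ord_neg.
by have := congr1 neg (geoP hx); rewrite rmorphM rmorphB !rmorph1.
Qed.

Lemma neg_isum g : neg (isum g) = isum (neg \o g).
Proof. by apply: fpsP => N; rewrite /= mulr_sumr. Qed.

(** The substitution q -> q^2, needed because B(q) + B(-q) is twice a series in q^2. *)
Definition dil2 f := Fps (fun n => if odd n then 0 else coef f n./2).

Fact dil2_is_additive : zmod_morphism dil2.
Proof. by move=> f g; apply: fpsP => n /=; case: odd; rewrite ?subr0. Qed.

Fact dil2_is_multiplicative : monoid_morphism dil2.
Proof.
split=> [|f g]; apply: fpsP => n.
  by case: n => [|[|n]] //=; rewrite /ps1 /=; case: odd.
rewrite coefM /=; case: ifPn => on.
  rewrite big1 // => i _ /=; rewrite oddB ?on; last by rewrite -ltnS.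
  by case: odd; rewrite ?mul0r //= mulr0.
have en : n = (2 * n./2)%N by rewrite mul2n even_halfK.
pose F i := (if odd i then 0 else coef f i./2) *
  (if odd (n - i) then 0 else coef g (n - i)./2).
transitivity (\sum_(i < 2 * (n./2).+1) F i).
  rewrite (big_ord_mul 2 _ F) /F; apply: eq_bigr => i _.
  rewrite !big_ord_recl big_ord0 /bump /= addr0.
  have lt_i := ltn_ord i.
  have -> : odd (2 * i + 0) = false by lia.
  have -> : odd (2 * i + (1 + 0)) = true by lia.
  have -> : odd (n - (2 * i + 0)) = false by lia.
  rewrite mul0r addr0; congr (coef f _ * coef g _); lia.
(* Summing in pairs adds one term beyond the Cauchy product, at the odd index n+1, where [F]
   vanishes. *)
have -> : (2 * (n./2).+1 = n.+2)%N by lia.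
by rewrite big_ord_recr /= {2}/F /= on mul0r addr0.
Qed.

HB.instance Definition _ := GRing.isZmodMorphism.Build fps fps dil2 dil2_is_additive.
HB.instance Definition _ :=
  GRing.isMonoidMorphism.Build fps fps dil2 dil2_is_multiplicative.

Lemma coef_dil2 f n : coef (dil2 f) (2 * n)%N = coef f n.
Proof. by rewrite mul2n /= odd_double doubleK. Qed.

Lemma dil2_inj : injective dil2.
Proof. by move=> f g e; apply: fpsP => n; rewrite -(coef_dil2 f) e coef_dil2. Qed.

Lemma dil2_q : dil2 q = q ^+ 2.
Proof.
apply: fpsP => n; rewrite coefXn /= /psX; case: ifP => o.
  by case: eqP o => // ->.
by congr (_%:R : int); congr nat_of_bool; apply/eqP/eqP; lia.
Qed.

Lemma ord_dil2 N f : ord N f -> ord N (dil2 f).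
Proof. by move=> h n lt_n /=; case: ifP => // _; apply: h; lia. Qed.

Lemma eqm_dil2 N f g : eqm N f g -> eqm N (dil2 f) (dil2 g).
Proof. by rewrite /eqm -rmorphB; apply: ord_dil2. Qed.

Lemma dil2_pinf x p : ord 1 p -> dil2 (pinf x p) = pinf (dil2 x) (dil2 p).
Proof.
move=> hp; apply: pinf_uniq => [|m]; first exact: ord_dil2.
exists m => //; have -> : poch (dil2 x) (dil2 p) m = dil2 (poch x p m).
  by rewrite rmorph_prod; apply: eq_bigr => i _; rewrite rmorphB rmorphM rmorphXn rmorph1.
exact/eqm_dil2/pinfP.
Qed.

Lemma dil2_isum g : fam g -> dil2 (isum g) = isum (dil2 \o g).
Proof.
move=> hg; apply: isum_uniq => [n|N]; first exact/ord_dil2/hg.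
exists N => //; rewrite -rmorph_sum; exact/eqm_dil2/isum_part.
Qed.

Lemma dil2_psi : dil2 (psi q) = psi (q ^+ 2).
Proof.
rewrite dil2_isum; last exact: fam_psi.
by apply: eq_isum => n; rewrite /= rmorphXn /= dil2_q.
Qed.

Definition Bq := Fps b.
Definition Beven := Fps (fun n => b (2 * n)%N).

Lemma Bq_neg : Bq + neg Bq = 2 * dil2 Beven.
Proof.
apply: fpsP => n; rewrite coefMnat /=; case: ifPn => on.
  by rewrite -signr_odd on mulN1r subrr mulr0.
rewrite -signr_odd (negbTE on) mul1r mulr_natl mulr2n.
by have -> : (2 * n./2 = n)%N by lia.
Qed.

Lemma exp_prod (x : fps) n : x ^+ n = \prod_(i < n) x.
Proof. by rewrite prodr_const card_ord. Qed.

Lemma exp_double (x : fps) n : x ^+ n.*2 = (x ^+ 2) ^+ n.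
Proof. by rewrite -mul2n exprM. Qed.

(** The i-th factor is q (1 + q^(2i+1)) / (1 - q^(2i+3)); the factor [1 - q] makes up for the
    denominators starting at q^3. *)
Lemma half_B n : half11 (q ^+ 2) (- q ^+ 2) (- q) q n = (1 - q) * Fps (Bterm n).
Proof.
rewrite BtermE [X in _ * (_ * (_ * X))]big_ord_recl /= expr1.
transitivity ((q ^+ n * \prod_(j < n) (1 + q ^+ j.*2.+1)) *
    \prod_(j < n) geo (q ^+ j.+1.*2.+1)); last first.
  transitivity ((1 - q) * geo q * ((q ^+ n * \prod_(j < n) (1 + q ^+ j.*2.+1)) *
    \prod_(j < n) geo (q ^+ j.+1.*2.+1))); first by rewrite geoP // mul1r.
  by ring.
rewrite (exp_prod q n) -!big_split; apply: eq_bigr => i _ /=.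
congr (_ * geo _).
  by rewrite (exprS q i.*2) exp_double; ring.
by rewrite doubleS !(exprS q _.+1) (exprS q _.*2) exp_double; ring.
Qed.

(** The factor of index 0 contributes the numerator 1 - q, and those of index i >= 1 contribute -q
    (1 - q^(2i-1)); this is the term of B(-q). *)
Lemma half_Bneg n :
  half11 (q ^+ 2) (- 1) q (- q) n.+1 = (1 - q) * neg (Fps (Bterm n)).
Proof.
rewrite BtermE !rmorphM !rmorph_prod rmorphXn /= neg_q.
rewrite /half11 big_split /=.
transitivity ((1 - q) * ((- q) ^+ n * \prod_(j < n) neg (1 + q ^+ j.*2.+1)) *
    \prod_(j < n.+1) neg (geo (q ^+ j.*2.+1))); last by ring.
congr (_ * _); last first.
  apply: eq_bigr => i _; rewrite neg_geo ?rmorphXn /= ?neg_q; last exact: ord_qX.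
  by rewrite (exprS (- q)) !exp_double sqrrN; congr geo; ring.
rewrite big_ord_recl /= expr0; congr (_ * _); first by ring.
rewrite (exp_prod (- q) n) -big_split; apply: eq_bigr => i _ /=.
rewrite rmorphD rmorph1 rmorphXn /= neg_q.
by rewrite (exprS (- q)) exp_double sqrrN /bump /= add1n (exprS (q ^+ 2)); ring.
Qed.

Lemma psi11_B : psi11 (q ^+ 2) (- q ^+ 2) (- 1) (- q) q = (1 - q) * (2 * dil2 Beven).
Proof.
have hq2 : ord 1 (q ^+ 2) by apply: ord_qX.
have hqN : ord 1 (- q) by apply: ordN.
rewrite -Bq_neg (_ : Bq = isum (fun k => Fps (Bterm k))); last exact: fpsP.
have hB : fam (fun k => Fps (Bterm k)).
  by move=> n; rewrite BtermE; apply/ordMr/ordX1.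
rewrite neg_isum mulrDr !isumMl // => [|n]; last exact/ord_neg/hB.
rewrite [X in _ = X + _]isum_rec => [|n]; last exact/ordMl/hB.
rewrite -half_B half0 -addrA isumD; congr (_ + _); apply: eq_isum => n /=.
by rewrite half_B half_Bneg.
Qed.

(** The 1psi1 sum at p = q^2, c = -q^2, d = -1, y = -q, z = q, read as an identity in q^2 and
    doubled. *)
Lemma Beven_prod : Beven * pinf q (q ^+ 2) ^+ 2 = pinf (- q) q * psi q.
Proof.
have hq2 : ord 1 (q ^+ 2) by apply: ord_qX.
have hqN : ord 1 (- q) by apply: ordN.
apply: dil2_inj; apply: (@fps_mulnI 2) => //.
have dM f g : dil2 (f * g) = dil2 f * dil2 g by rewrite rmorphM.
have dq2 : dil2 (q ^+ 2) = (q ^+ 2) ^+ 2 by rewrite expr2 dM dil2_q.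
rewrite expr2 !dM !dil2_pinf // dq2 rmorphN /= dil2_q dil2_psi -expr2.
have ep : q ^+ 2 = (- q ^+ 2) * (- 1) by ring.
have := psi11_pinf_theta ep hq2 hqN ord_q.
have -> : - q ^+ 2 * - q = q * q ^+ 2 by ring.
rewrite psi11_B -psi2_theta // mulN1r (mulNr q) -expr2.
rewrite -(pinfN q hq2) (pinf_rec q hq2) => e.
transitivity (pinf (- q ^+ 2) (q ^+ 2) * (2 * psi (q ^+ 2))); last by ring.
by rewrite -e; ring.
Qed.

Lemma Beven_phi : Beven * phi q = psi q ^+ 2.
Proof.
rewrite phi_pinf // mulrA Beven_prod expr2 [X in _ = _ * X]psi_pinf //; ring.
Qed.

(** The truncated products agree with the infinite ones up to q^n, so [eta41_theta] applies. *)
Lemma aE n : a n = coef (phi q ^+ 3 * psi q ^+ 2) n.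
Proof.
have f_truncE m N : Fps (f_trunc m N) = poch (q ^+ m) (q ^+ m) N.
  rewrite /f_trunc psprodE -[iota 1 N]/(iota (1 + 0) N) iotaDl big_map.
  rewrite -(subn0 N) -/(index_iota 0 _) big_mkord subn0; apply: eq_bigr => i _.
  by rewrite oneMinusXE -exprM -exprD mulnDr muln1.
have h m : (0 < m)%N -> eqm n.+1 (Fps (f_trunc m n)) (pinf (q ^+ m) (q ^+ m)).
  move=> m0; rewrite f_truncE; apply: eqm_sym.
  apply: eqm_trans (pinfP _ (ord_qX m0) (leqnn _)) _.
  rewrite /eqm pochS mulrBr mulr1 addrAC subrr add0r -exprS.
  by apply/ordN/ordMl/ordX1/ord_qX.
rewrite -eta41_theta //.
rewrite -[LHS]/(coef (Fps (psprod [seq f_trunc m n | m <- [:: 1; 1; 1; 1; 2]%N])) n).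
rewrite psprodE !big_cons big_nil mulr1 !mulrA; apply: (@eqm_coef n.+1) => //.
rewrite [_ ^+ 4]exprS [_ ^+ 3]exprS expr2 !mulrA.
by do 4!(apply: eqmM; last exact: h); apply: h.
Qed.

(** * Dissections *)

Definition supp m r f := forall n, n != r %[mod m] -> coef f n = 0.

Lemma suppM m r s f g : supp m r f -> supp m s g -> supp m (r + s) (f * g).
Proof.
move=> hf hg n ne; rewrite coefM big1 // => i _.
have [ei|ni] := eqVneq (i %% m)%N (r %% m)%N; last by rewrite hf ?mul0r.
rewrite hg ?mulr0 //; apply: contra ne => /eqP e.
by rewrite -{1}(subnKC (ltn_ord i : (i <= n)%N)) -modnDm ei e modnDm.
Qed.
Lemma suppM0 m f g : supp m 0 f -> supp m 0 g -> supp m 0 (f * g).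
Proof. exact: suppM. Qed.
Lemma suppD m r f g : supp m r f -> supp m r g -> supp m r (f + g).
Proof. by move=> hf hg n ne; rewrite coefD hf // hg. Qed.
Lemma suppN m r f : supp m r f -> supp m r (- f).
Proof. by move=> hf n ne; rewrite coefN hf // oppr0. Qed.
Lemma supp1 m : supp m 0 1.
Proof. by case=> // /eqP. Qed.
Lemma supp_nat m k : supp m 0 k%:R.
Proof.
by elim: k => // k IH; rewrite -addn1 natrD; apply: suppD IH _; apply: supp1.
Qed.
Lemma suppX m f n : supp m 0 f -> supp m 0 (f ^+ n).
Proof.
move=> hf; elim: n => [|n IH]; first exact: supp1.
by rewrite exprS; apply: (suppM hf IH).
Qed.
Lemma supp_qX m k : supp m k (q ^+ k).
Proof. by move=> n ne; rewrite coefXn; case: (n =P k) ne => // -> /eqP. Qed.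
Lemma supp_qX0 m k : (m %| k)%N -> supp m 0 (q ^+ k).
Proof. by move=> dv n ne; apply: (@supp_qX m k); rewrite (eqP dv) -(mod0n m). Qed.
Lemma supp_isum m r g : (forall n, supp m r (g n)) -> supp m r (isum g).
Proof. by move=> h n ne; rewrite coef_isum big1 // => i _; apply: h. Qed.
Lemma supp_theta m p c d : supp m 0 p -> supp m 0 c -> supp m 0 d ->
  supp m 0 (theta p c d).
Proof.
move=> hp hc hd; apply: suppD; first exact: supp1.
apply: supp_isum => n; apply: suppD; rewrite -[0%N]addn0; apply: suppM;
  by apply: suppX => //; apply: suppN.
Qed.
Lemma supp_phi m x : supp m 0 x -> supp m 0 (phi x).
Proof. by move=> h; apply: supp_theta => //; apply: suppX. Qed.
Lemma supp_psi m x : supp m 0 x -> supp m 0 (psi x).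
Proof. by move=> h; apply: supp_isum => n; apply: suppX. Qed.

Definition part m r f := Fps (fun n => if n == r %[mod m] then coef f n else 0).

Lemma partD m r f g : part m r (f + g) = part m r f + part m r g.
Proof. by apply: fpsP => n /=; case: eqP. Qed.
Lemma part_id m r f : supp m r f -> part m r f = f.
Proof. by move=> h; apply: fpsP => n /=; case: eqP => // /eqP /h ->. Qed.
Lemma part_0 m r s f : supp m s f -> s != r %[mod m] -> part m r f = 0.
Proof.
move=> h ne; apply: fpsP => n /=; case: eqP => // e.
by apply: h; rewrite e eq_sym.
Qed.
(** Extracting a residue class of exponents is linear over the series in q^m. *)
Lemma partMr m r f g : supp m 0 g -> part m r (f * g) = part m r f * g.
Proof.
move=> hg; apply: fpsP => n; rewrite coefM /=; case: ifPn => en.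
  rewrite /psmul; apply: eq_bigr => i _ /=; case: ifPn => // ni.
  rewrite hg ?mulr0 //; apply: contra ni => /eqP e.
  by rewrite -(eqP en) -{2}(subnKC (ltn_ord i : (i <= n)%N)) -modnDm e mod0n addn0 modn_mod.
rewrite big1 // => i _ /=; case: ifPn => ei; last by rewrite mul0r.
rewrite hg ?mulr0 //; apply: contra en => /eqP e.
by rewrite -(eqP ei) -{1}(subnKC (ltn_ord i : (i <= n)%N)) -modnDm e mod0n addn0 modn_mod.
Qed.

Lemma phi_odd x : exists t, phi x = 1 + 2 * t.
Proof.
eexists; rewrite /phi /theta -isumD; congr (_ + _).
by rewrite mulrDl mul1r.
Qed.

(** * The 3-dissection of a theta series *)

Lemma thetaC p c d : theta p c d = theta p d c.
Proof. by congr (_ + _); apply: eq_isum => n; rewrite addrC. Qed.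

Lemma fam_theta_half (p c : fps) : ord 1 p ->
  fam (fun n => (- c) ^+ n.+1 * p ^+ 'C(n.+1, 2)).
Proof. by move=> hp n; apply: ordMl; apply: ordW (leq_bin2 n) (ordX1 hp). Qed.

Lemma thetaE (p c d : fps) : theta p c d =
  1 + isum (fun n => (- c) ^+ n.+1 * p ^+ 'C(n.+1, 2)) +
  isum (fun n => (- d) ^+ n.+1 * p ^+ 'C(n.+1, 2)).
Proof. by rewrite -addrA isumD. Qed.

Section ThetaSplit.
Variables (p c d : fps).
Hypothesis ep : p = c * d.
Let term (u v : fps) n : fps := (- v) ^+ n * u ^+ 'C(n, 2).

Lemma theta_term0 m :
  term p c (3 * m + 2).+1 = term (p ^+ 9) (c ^+ 6 * d ^+ 3) m.+1.
Proof.
rewrite /term; have -> : ('C((3 * m + 2).+1, 2) = 3 * m.+1 + 9 * 'C(m.+1, 2))%N.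
  by have := bin2_mul (3 * m + 2).+1; have := bin2_mul m.+1; nia.
have -> : (3 * m + 2).+1 = (3 * m.+1)%N by lia.
rewrite exprD (exprM (- c) 3) (exprM p 3) (exprM p 9) mulrA -exprMn.
by congr (_ ^+ _ * _); rewrite ep; ring.
Qed.

Lemma theta_term1 m :
  term p c (3 * m + 0).+1 = - c * term (p ^+ 9) (c ^+ 9 * d ^+ 6) m.
Proof.
rewrite /term; have -> : ('C((3 * m + 0).+1, 2) = 6 * m + 9 * 'C(m, 2))%N.
  have := bin2_mul (3 * m + 0).+1; have := bin2_mul m; case: m => [|m]; nia.
rewrite addn0 exprS exprD (exprM (- c) 3) (exprM p 6) (exprM p 9) -mulrA.
congr (_ * _); rewrite mulrA -exprMn.
by congr (_ ^+ _ * _); rewrite ep; ring.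
Qed.

Lemma theta_term2 m :
  term p c (3 * m + 1).+1 = - d * term (p ^+ 9) (c ^+ 3) m.+1.
Proof.
rewrite /term; have -> : ('C((3 * m + 1).+1, 2) = 1 + 9 * 'C(m.+1, 2))%N.
  by have := bin2_mul (3 * m + 1).+1; have := bin2_mul m.+1; nia.
rewrite exprD expr1 [p ^+ (9 * _)]exprM !mulrA; congr (_ * _).
have -> : - c ^+ 3 = (- c) ^+ 3 by ring.
have e : (3 * m.+1 = (3 * m + 1).+2)%N by lia.
by rewrite -exprM e (exprS (- c) _.+1) ep; ring.
Qed.
End ThetaSplit.

(** The summation index is split as 3k, 3k+1 and 3k-1; each class is again a theta series, in base
    p^9. Each of the last two classes combines terms from both halves. *)
Lemma theta_split3 (p c d : fps) : p = c * d -> ord 1 p ->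
  theta p c d = theta (p ^+ 9) (c ^+ 6 * d ^+ 3) (d ^+ 6 * c ^+ 3)
    - c * theta (p ^+ 9) (c ^+ 9 * d ^+ 6) (d ^+ 3)
    - d * theta (p ^+ 9) (d ^+ 9 * c ^+ 6) (c ^+ 3).
Proof.
move=> ep hp; have ep' : p = d * c by rewrite mulrC.
have hp9 : ord 1 (p ^+ 9) by apply: ordX_gt0.
have fp x := fam_theta_half x hp; have fp9 x := fam_theta_half x hp9.
(* The class of 3m+1 starts at m = 0, so it already contains the constant term of its theta
   series. *)
have lead (x y : fps) : p = x * y ->
  1 + isum (fun n => (- (x ^+ 9 * y ^+ 6)) ^+ n.+1 * (p ^+ 9) ^+ 'C(n.+1, 2)) =
  isum (fun n => (- (x ^+ 9 * y ^+ 6)) ^+ n * (p ^+ 9) ^+ 'C(n, 2)).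
  move=> e; rewrite [RHS]isum_rec ?expr0 ?mulr1 // => n.
  apply/ordMr/ordX1; have -> : x ^+ 9 * y ^+ 6 = p ^+ 6 * x ^+ 3 by rewrite e; ring.
  by apply/ordN/ordMr/ordX_gt0.
rewrite !thetaE (lead _ _ ep) (lead _ _ ep').
rewrite (isum_mul (isT : (0 < 3)%N) (fp c)) (isum_mul (isT : (0 < 3)%N) (fp d)).
have hl (x y : fps) : p = x * y ->
  isum (fun m => \sum_(j < 3)
     (- x) ^+ (3 * m + j).+1 * p ^+ 'C((3 * m + j).+1, 2)) =
  isum (fun n => (- (x ^+ 6 * y ^+ 3)) ^+ n.+1 * (p ^+ 9) ^+ 'C(n.+1, 2)) -
  x * isum (fun n => (- (x ^+ 9 * y ^+ 6)) ^+ n * (p ^+ 9) ^+ 'C(n, 2)) -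
  y * isum (fun n => (- (x ^+ 3)) ^+ n.+1 * (p ^+ 9) ^+ 'C(n.+1, 2)).
  move=> e; rewrite !isumMl // => [|n]; last first.
    apply/ordMr/ordX1; have -> : x ^+ 9 * y ^+ 6 = p ^+ 6 * x ^+ 3 by rewrite e; ring.
    by apply/ordN/ordMr/ordX_gt0.
  rewrite !isumN !isumD; apply: eq_isum => m.
  rewrite !big_ord_recl big_ord0 /bump /= addr0.
  by rewrite (theta_term0 e) (theta_term1 e) (theta_term2 e) !mulNr; ring.
rewrite (hl _ _ ep) (hl _ _ ep'); ring.
Qed.

(** * The congruences modulo 9 and 8 *)

Lemma phi_split3 (x : fps) : ord 1 x ->
  phi x = phi (x ^+ 9) - 2 * (x * theta (x ^+ 18) (x ^+ 3) (x ^+ 15)).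
Proof.
move=> hx; rewrite {1}/phi theta_split3 ?expr2 //; last exact: ordMr.
rewrite -!exprD /= -expr2 -exprM (thetaC _ (x ^+ (9 + 6)) _) /phi -exprM.
by move: (theta _ _ _) (theta _ _ _) => u v; ring.
Qed.

(** Dissect 2 psi(x), the theta series with c = -x and d = -1: two of the three components coincide,
    and the third is 2 x psi(x^9). *)
Lemma psi_split3 (x : fps) : ord 1 x ->
  psi x = theta (x ^+ 9) (- x ^+ 3) (- x ^+ 6) + x * psi (x ^+ 9).
Proof.
move=> hx; apply: (@fps_mulnI 2) => //.
rewrite mulrDr mulrCA !psi2_theta //; last exact: ordX_gt0.
rewrite theta_split3 //; last by ring.
have -> : (- x) ^+ 6 * (- 1) ^+ 3 = - x ^+ 6 by ring.
have -> : (- 1) ^+ 6 * (- x) ^+ 3 = - x ^+ 3 by ring.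
have -> : (- x) ^+ 9 * (- 1) ^+ 6 = - x ^+ 9 by ring.
have -> : (- 1) ^+ 3 = - 1 :> fps by ring.
have -> : (- 1) ^+ 9 * (- x) ^+ 6 = - x ^+ 6 by ring.
have -> : (- x) ^+ 3 = - x ^+ 3 by ring.
by rewrite (thetaC _ (- x ^+ 6)); ring.
Qed.

(** This is W A = f g, taken at x = q^3. Euler's identity for x, split modulo 3, and Euler's
    identity for x^3 reduce both sides to (x^3; x^3)_∞^2 (-x^3; x^3)_∞. *)
Lemma theta_cubic_product (x : fps) : ord 1 x ->
  theta (x ^+ 6) x (x ^+ 5) * theta (x ^+ 3) (- x) (- x ^+ 2) =
  phi (x ^+ 3) * psi (x ^+ 3).
Proof.
move=> hx; have hX k : (0 < k)%N -> ord 1 (x ^+ k) by move=> k0; apply: ordX_gt0.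
have h3 := hX 3%N isT; have h6 := hX 6%N isT.
have ep6 : x ^+ 6 = x * x ^+ 5 by ring.
have ep3 : x ^+ 3 = (- x) * (- x ^+ 2) by ring.
rewrite (phi_pinf h3) (psi_pinf h3) (jacobi_triple ep6 h6) (jacobi_triple ep3 h3).
have e2 := euler_odd_distinct h3; have e3 := pinf_even h3.
have e1 := euler_odd_distinct hx.
rewrite (pinf_split3 (- x) hx) (pinf_split3 x (hX 2%N isT)) in e1.
have E1 : - x * x = - x ^+ 2 by ring.
have E2 : - x * x ^+ 2 = - x ^+ 3 by ring.
have E3 : (x ^+ 2) ^+ 3 = x ^+ 6 by ring.
have E4 : x * x ^+ 2 = x ^+ 3 by ring.
have E5 : x * (x ^+ 2) ^+ 2 = x ^+ 5 by ring.
have E6 : (x ^+ 3) ^+ 2 = x ^+ 6 by ring.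
rewrite E1 E2 E3 E4 E5 in e1; rewrite E6 in e2 e3; rewrite E6 -e3.
move: (pinf (- x) (x ^+ 3)) (pinf (- x ^+ 2) (x ^+ 3)) e1 => u1 u2.
move: (pinf x (x ^+ 6)) (pinf (x ^+ 5) (x ^+ 6)) => o1 o5.
move: (pinf (- x ^+ 3) (x ^+ 3)) (pinf (x ^+ 3) (x ^+ 6)) e2 => u3 o3 e2.
move: (pinf (x ^+ 3) (x ^+ 3)) => f e1.
transitivity (o1 * o5 * u1 * u2 * (u3 * o3) * (f * f * u3)); last first.
  transitivity ((u1 * u2 * u3 * (o1 * o3 * o5)) * (f * f * u3)); first by ring.
  rewrite e1; transitivity ((u3 * o3) ^+ 2 * (f * f * u3)); last by ring.
  by rewrite e2; ring.
by rewrite e2; ring.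
Qed.

Lemma phi_ord x : ord 1 x -> ord 1 (1 - phi x).
Proof.
move=> hx; rewrite /phi /theta opprD addNKr; apply: ordN => -[] // _.
rewrite coef_isum big_ord1; apply: (@ordD 1) => //;
  by apply: ordMr; apply: ordX_gt0 => //; apply: ordN.
Qed.

Lemma dvdz9_b k : (9 %| b (2 * (3 * k + 2))%N)%Z.
Proof.
have sy n : (0 < n)%N -> supp 3 0 (q ^+ (3 * n)).
  by move=> n0; apply: supp_qX0; apply: dvdn_mulr.
pose Wt : fps := theta (q ^+ 18) (q ^+ 3) (q ^+ 15).
pose At : fps := theta (q ^+ 9) (- q ^+ 3) (- q ^+ 6).
pose f : fps := phi (q ^+ 9); pose g : fps := psi (q ^+ 9).
have sW : supp 3 0 Wt.
  by apply: supp_theta; [apply: (sy 6)|apply: (sy 1)|apply: (sy 5)].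
have sA : supp 3 0 At.
  by apply: supp_theta; [apply: (sy 3)|apply/suppN/(sy 1)|apply/suppN/(sy 2)].
have sf : supp 3 0 f by apply/supp_phi/(sy 3).
have sg : supp 3 0 g by apply/supp_psi/(sy 3).
have eW : Wt * At = f * g.
  have := theta_cubic_product (ord_qX (isT : (0 < 3)%N)).
  by rewrite -!exprM.
have ephi : phi q = f - 2 * (q * Wt) by apply: phi_split3.
have epsi : psi q = At + q * g by apply: psi_split3.
have f1 : ord 1 (1 - f) by apply/phi_ord/ord_qX.
clearbody Wt At f g.
(* The factor f^2 + 2 q f W + 4 q^2 W^2 turns phi = f - 2 q W into this difference of cubes, an
   invertible series in q^3. *)
pose F := f ^+ 3 - 8 * (q ^+ 3 * Wt ^+ 3).
have sF : supp 3 0 F.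
  by rewrite /F; repeat first [assumption | exact: (sy 1%N) | apply: supp_nat | apply: suppX | apply: suppD
    | apply: suppN | apply: suppM0].
have oF : ord 1 (1 - F).
  have -> : 1 - F = (1 - f) * (1 + f + f ^+ 2) + 8 * (q ^+ 3 * Wt ^+ 3).
    by rewrite /F; ring.
  apply: ordD; first exact: ordMr.
  by apply/ordMl/ordMr/ord_qX.
(* [G0] and [G1 * q] collect the exponents 0 and 1 modulo 3 of psi^2 (f^2 + 2 q f W + 4 q^2 W^2). *)
pose G0 := At ^+ 2 * f ^+ 2 + q ^+ 3 * (8 * (At * Wt ^+ 2 * g) + 2 * (f * Wt * g ^+ 2)).
pose G1 := 2 * (At ^+ 2 * f * Wt + At * g * f ^+ 2) + q ^+ 3 * (4 * (Wt ^+ 2 * g ^+ 2)).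
have s0 : supp 3 0 G0.
  by rewrite /G0; repeat first [assumption | exact: (sy 1%N) | apply: supp_nat | apply: suppX | apply: suppD
    | apply: suppN | apply: suppM0].
have s1 : supp 3 0 G1.
  by rewrite /G1; repeat first [assumption | exact: (sy 1%N) | apply: supp_nat | apply: suppX | apply: suppD
    | apply: suppN | apply: suppM0].
have s2 : supp 3 0 (9 * (f * g) ^+ 2).
  by repeat first [assumption | exact: (sy 1%N) | apply: supp_nat | apply: suppX | apply: suppD
    | apply: suppN | apply: suppM0].
have eE : Beven * F = G0 + G1 * q + 9 * (f * g) ^+ 2 * q ^+ 2.
  have -> : Beven * F = Beven * phi q * (f ^+ 2 + 2 * (f * q * Wt) + 4 * (q * Wt) ^+ 2).
    by rewrite ephi /F; ring.
  rewrite Beven_phi epsi /G0 /G1.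
  have -> : 9 * (f * g) ^+ 2 = 4 * (Wt * At) ^+ 2 + 4 * (f * g) * (Wt * At) + (f * g) ^+ 2.
    by rewrite eW; ring.
  ring.
clearbody G0 G1 F.
have ep : part 3 2 Beven * F = 9 * (f * g) ^+ 2 * q ^+ 2.
  rewrite -partMr // eE !partD (part_0 s0) // add0r.
  rewrite (part_0 (suppM s1 (@supp_qX 3 1))) // add0r part_id //.
  exact: (suppM s2 (@supp_qX 3 2)).
have := geoP oF; rewrite subKr => eG.
have : part 3 2 Beven = 9 * ((f * g) ^+ 2 * q ^+ 2 * geo (1 - F)).
  transitivity (9 * (f * g) ^+ 2 * q ^+ 2 * geo (1 - F)); last by ring.
  by rewrite -ep -mulrA eG mulr1.
move/(congr1 (fun h => coef h (3 * k + 2)%N)); rewrite coefMnat.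
have -> : coef (part 3 2 Beven) (3 * k + 2)%N = b (2 * (3 * k + 2))%N.
  by rewrite [LHS]ifT //; lia.
by move=> ->; apply: dvdz_mulr.
Qed.

Lemma phi4_mod8 x : exists t, phi x ^+ 4 = 1 + 8 * t.
Proof.
have [t ->] := phi_odd x; exists (t + 3 * t ^+ 2 + 4 * t ^+ 3 + 2 * t ^+ 4); ring.
Qed.

Lemma b_a_mod8 k : (8 %| b (2 * k)%N - a k)%Z.
Proof.
have [t et] := phi4_mod8 q.
have e : phi q ^+ 3 * psi q ^+ 2 = Beven + 8 * (Beven * t).
  rewrite -Beven_phi; transitivity (Beven * phi q ^+ 4); first by ring.
  by rewrite et; ring.
rewrite aE e coefD coefMnat /= opprD addrA subrr add0r.
by rewrite -mulrN dvdz_mulr.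
Qed.

(** The odd part of [phi q] is -2 times this series. *)
Definition k8 : fps := q * psi (q ^+ 8).

Lemma a_mod8 : exists h,
  phi q ^+ 3 * psi q ^+ 2 = psi (q ^+ 2) - 4 * (k8 * psi (q ^+ 2)) + 8 * h.
Proof.
have [t et] := phi_odd (- q ^+ 4).
have e1 : phi q = phi (- q ^+ 4) - 2 * k8 by apply: phi_split2.
have e2 : phi (- q) = phi (- q ^+ 4) + 2 * k8.
  rewrite phi_split2; last exact: ordN.
  have -> : (- q) ^+ 4 = q ^+ 4 by ring.
  have -> : (- q) ^+ 8 = q ^+ 8 by ring.
  rewrite /k8; ring.
rewrite psi_sqr // e1 e2 et; move: (psi (q ^+ 2)) k8 => s u.
(* With P = 1 + 2t, one has (P - 2u)^3 (P + 2u) = P^4 - 4 P^3 u + 16 P u^3 - 16 u^4; the witness is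
   what remains of it, divided by 8, after 1 - 4u is removed. *)
exists (s * ((t + 3 * t ^+ 2 + 4 * t ^+ 3 + 2 * t ^+ 4)
  - u * (3 * t + 6 * t ^+ 2 + 4 * t ^+ 3) + 2 * (1 + 2 * t) * u ^+ 3 - 2 * u ^+ 4)).
ring.
Qed.

Lemma supp_psi_q2 : supp 2 0 (psi (q ^+ 2)).
Proof. exact/supp_psi/supp_qX0. Qed.

Lemma supp_k8 : supp 2 1 (k8 * psi (q ^+ 2)).
Proof.
rewrite -[1%N]/(1 + 0 + 0)%N; apply: suppM supp_psi_q2.
by apply: suppM; [apply: (@supp_qX 2 1)|apply/supp_psi/supp_qX0].
Qed.

Lemma a_even_mod8 m : ~~ odd m -> (8 %| a m - coef (psi (q ^+ 2)) m)%Z.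
Proof.
move=> em; have [h e] := a_mod8.
rewrite aE e coefD coefB !coefMnat supp_k8 ?modn2 ?(negbTE em) //.
by rewrite mulr0 subr0 addrAC subrr add0r dvdz_mulr.
Qed.

Lemma a_odd_mod8 m : odd m -> (8 %| a m + 2 * coef (psi q ^+ 2) m)%Z.
Proof.
move=> om; have [h e] := a_mod8.
(* The odd part of psi^2 is 2 q psi(q^8) psi(q^2), so the term with coefficient -4 in [a_mod8] is -2
   times it. *)
have -> : psi q ^+ 2 = phi (- q ^+ 4) * psi (q ^+ 2) + 2 * (k8 * psi (q ^+ 2)).
  rewrite psi_sqr // phi_split2; last exact: ordN.
  have -> : (- q) ^+ 4 = q ^+ 4 by ring.
  have -> : (- q) ^+ 8 = q ^+ 8 by ring.
  rewrite /k8; ring.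
have sp : supp 2 0 (phi (- q ^+ 4) * psi (q ^+ 2)).
  by apply: suppM0 supp_psi_q2; apply/supp_phi/suppN/supp_qX0.
rewrite aE e !coefD coefN !coefMnat sp ?modn2 ?om // supp_psi_q2 ?modn2 ?om //.
rewrite (_ : _ + _ = 8%:R * coef h m); first by rewrite dvdz_mulr.
ring.
Qed.

(** The condition m = i(i+1) means 4m+1 = (2i+1)^2, and at most one i satisfies it. *)
Lemma coef_psi_q2 m : coef (psi (q ^+ 2)) m = [exists i : 'I_m.+1, (i * i.+1 == m)%N]%:R.
Proof.
rewrite coef_isum.
have e n : coef ((q ^+ 2) ^+ 'C(n.+1, 2)) m = (n * n.+1 == m)%N%:R.
  rewrite -exprM coefXn eq_sym; congr ((_ == _)%:R : int).
  by rewrite mulnC bin2_mul mulnC.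
under eq_bigr do rewrite e.
case: existsP => [[i /eqP ei]|ni]; last first.
  by rewrite big1 // => i _; case: eqP => // ei; case: ni; exists i; apply/eqP.
rewrite (bigD1 i) //= ei eqxx big1 ?addr0 // => j nj; case: eqP => // ej.
case/eqP: nj; apply: val_inj; rewrite /=; nia.
Qed.

(** * The square of psi as a Lambert series *)

Definition chi4 (n : nat) : int :=
  if (n %% 4 == 1)%N then 1 else if (n %% 4 == 3)%N then -1 else 0.

(** The function D of the opening sketch. *)
Definition chi_sum N : int := \sum_(d <- divisors N) chi4 d.

(** The bilateral sum of q^n / (1 - q^(4n+1)); the term of index -(n+1) equals -q^(3n+2) / (1 -
    q^(4n+3)). *)
Definition lambert4 : fps :=
  isum (fun n => q ^+ n * geo (q ^+ (4 * n).+1) - q ^+ (3 * n).+2 * geo (q ^+ (4 * n).+3)).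

(** The i-th factor is q (1 - q^(4i+1)) / (1 - q^(4i+5)), so the product telescopes. *)
Lemma half_lambert n :
  half11 (q ^+ 4) (q ^+ 2) (q ^+ 3) q n = (1 - q) * (q ^+ n * geo (q ^+ (4 * n).+1)).
Proof.
elim: n => [|n IH]; first by rewrite half0 muln0 expr0 mul1r geoP.
have := geoP (ord_qX (ltn0Sn (4 * n))).
rewrite halfS IH (exprS q (4 * n)) exprM; move: (geo (q * _)) => G eG.
have -> : geo (q ^+ (4 * n.+1).+1) = geo (q ^+ 2 * q ^+ 3 * (q ^+ 4) ^+ n).
  by congr geo; rewrite -exprM -!exprD; congr (_ ^+ _); lia.
transitivity ((1 - q) * (q ^+ n * q * geo (q ^+ 2 * q ^+ 3 * (q ^+ 4) ^+ n)) *
  ((1 - q * (q ^+ 4) ^+ n) * G)); first by ring.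
by rewrite eG (exprS q n); ring.
Qed.

Lemma half_lambert' n :
  half11 (q ^+ 4) (q ^+ 2) q (q ^+ 3) n.+1 =
  - ((1 - q) * (q ^+ (3 * n).+2 * geo (q ^+ (4 * n).+3))).
Proof.
elim: n => [|n IH].
  rewrite halfS half0 !muln0 expr0 (_ : q ^+ 2 * q * 1 = q ^+ 3); ring.
have := geoP (ord_qX (ltn0Sn (4 * n).+2)).
rewrite halfS IH; move: (geo (q ^+ (4 * n).+3)) => G eG.
have -> : geo (q ^+ (4 * n.+1).+3) = geo (q ^+ 2 * q * (q ^+ 4) ^+ n.+1).
  by congr geo; rewrite -exprM -exprSr -exprD; congr (_ ^+ _); lia.
have -> : (q ^+ 4) ^+ n.+1 = q * q ^+ (4 * n).+3.
  by rewrite -exprM -exprS; congr (_ ^+ _); lia.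
have -> : q ^+ (3 * n.+1).+2 = q ^+ (3 * n).+2 * q ^+ 3.
  by rewrite -exprD; congr (_ ^+ _); lia.
move: (geo (_ * _)) => H; move: (q ^+ (4 * n).+3) eG => u eG.
transitivity (- ((1 - q) * (q ^+ (3 * n).+2 * q ^+ 3 * H)) * ((1 - u) * G)).
  by ring.
by rewrite eG mulr1.
Qed.

Lemma lambert4_psi11 :
  psi11 (q ^+ 4) (q ^+ 2) (q ^+ 2) (q ^+ 3) q = (1 - q) * lambert4.
Proof.
rewrite /psi11 -isumD addrA.
have f1 : fam (fun n => half11 (q ^+ 4) (q ^+ 2) (q ^+ 3) q n).
  by move=> n; rewrite half_lambert; apply/ordMl/ordMr/ordX1.
have -> : 1 + isum (fun n => half11 (q ^+ 4) (q ^+ 2) (q ^+ 3) q n.+1) =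
    isum (fun n => half11 (q ^+ 4) (q ^+ 2) (q ^+ 3) q n).
  by rewrite [RHS]isum_rec ?half0.
rewrite isumD /lambert4 isumMl => [|n].
  by apply: eq_isum => n; rewrite half_lambert half_lambert'; ring.
apply: ordB; apply: ordMr; first exact: ordX1.
by apply: ordW (ordX1 ord_q); lia.
Qed.

(** The 1psi1 sum at p = q^4, c = d = q^2, y = q^3, z = q; the product side becomes psi^2 once (q;
    q^2)_∞^2 is cancelled. *)
Lemma lambert4_psi : lambert4 = psi q ^+ 2.
Proof.
have h2 : ord 1 (q ^+ 2) by apply: ord_qX.
have h3 : ord 1 (q ^+ 3) by apply: ord_qX.
have h4 : ord 1 (q ^+ 4) by apply: ord_qX.
have ep : q ^+ 4 = q ^+ 2 * q ^+ 2 by ring.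
have := psi11_pinf_theta ep h4 h3 ord_q; rewrite lambert4_psi11.
have -> : theta (q ^+ 4) (q ^+ 2) (q ^+ 2) = phi (q ^+ 2) by rewrite /phi -exprM.
have e22 : (q ^+ 2) ^+ 2 = q ^+ 4 by rewrite -exprM.
have e23 : q ^+ 2 * q ^+ 3 = q * q ^+ 4 by ring.
have e21 : q ^+ 2 * q = q ^+ 3 by ring.
have e31 : q ^+ 3 * q = q ^+ 4 by ring.
have e12 : q * q ^+ 2 = q ^+ 3 by ring.
rewrite (phi_pinf h2) (psi_pinf ord_q) e22 e23 e21 e31.
have eu := pinf_split2 q h2; rewrite e22 e12 in eu.
have ev := pinf_odd_even h2; rewrite e22 in ev.
have e1 := pinf_rec q h4.
have eE := euler_odd_distinct ord_q.
have hu := pinf_unit ord_q h2.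
rewrite ev; move: (pinf (- q) q) eE => g eE.
move: (pinf (q ^+ 2) (q ^+ 4)) (pinf (q ^+ 4) (q ^+ 4)) => w f.
move: (pinf (q * q ^+ 4) (q ^+ 4)) e1 => o5 e1.
move: (pinf q (q ^+ 4)) (pinf (q ^+ 3) (q ^+ 4)) eu e1 => o1 o3.
move: (pinf q (q ^+ 2)) hu eE => u hu eE eu e1 e.
apply: (fps_mulI hu); apply: (fps_mulI hu).
transitivity ((g * u) ^+ 2 * (f * (w ^+ 2 * f))); last by ring.
rewrite eE expr1n mul1r -e eu.
by transitivity (((1 - q) * o5) * o1 * o3 ^+ 2 * lambert4); [rewrite -e1|]; ring.
Qed.

Lemma coef_qXM k f n :
  coef (q ^+ k * f) n = if (k <= n)%N then coef f (n - k)%N else 0.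
Proof.
rewrite coefM; case: leqP => [le_kn|lt_nk].
  have lt_k : (k < n.+1)%N by [].
  rewrite (bigD1 (Ordinal lt_k)) //= coefXn eqxx mul1r big1 ?addr0 // => i ni.
  rewrite coefXn; case: eqP => [e|]; last by rewrite mul0r.
  by case/eqP: ni; apply: val_inj.
rewrite big1 // => i _; rewrite coefXn; case: eqP => [e|]; last by rewrite mul0r.
by have := ltn_ord i; lia.
Qed.

(** From 4m+1 = 4(m-n) + (4n+1) and 4m+1 = 4(m-3n-2) + 3(4n+3), the geometric series detect the
    divisors of 4m+1 that are 1 and 3 modulo 4. *)
Lemma chi_sum_lambert m : coef lambert4 m = chi_sum (4 * m).+1.
Proof.
pose F d : int := if (d %| (4 * m).+1)%N then chi4 d else 0.
transitivity (\sum_(d < 4 * m.+1) F d).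
  rewrite (big_ord_mul 4 _ F) coef_isum; apply: eq_bigr => n _.
  rewrite coefB !big_ord_recl big_ord0 /bump [RHS]/=.
  have lt_n := ltn_ord n.
  have F0 : F (4 * n + 0)%N = 0.
    by rewrite /F /chi4; case: ifP => // _; rewrite !ifF //; lia.
  have F2 : F (4 * n + 2)%N = 0.
    by rewrite /F /chi4; case: ifP => // _; rewrite !ifF //; lia.
  have F1 : F (4 * n + 1)%N = ((4 * n).+1 %| (4 * m).+1)%N%:R.
    by rewrite /F /chi4 addn1; case: ifP => // _; rewrite ifT //; lia.
  have F3 : F (4 * n + 3)%N = - ((4 * n).+3 %| (4 * m).+1)%N%:R.
    by rewrite /F /chi4 addn3; case: ifP => // _; rewrite ifF ?ifT //; lia.
  rewrite F0 F1 F2 F3 addr0 !add0r.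
  have cop k : odd k -> coprime k 4 by move=> ok; apply: (@coprimeXr 2 k 2); rewrite coprimen2.
  congr (_ - _).
    rewrite coef_qXM -ltnS lt_n coef_geo_qX //.
    rewrite -(@Gauss_dvdr _ 4 (m - n)) ?cop //; last by lia.
    have -> : ((4 * m).+1 = 4 * (m - n) + (4 * n).+1)%N by lia.
    by rewrite dvdn_addl.
  rewrite coef_qXM; have [le_m|lt_m] := leqP (3 * n).+2 m.
    rewrite coef_geo_qX // -(@Gauss_dvdr _ 4 (m - _)) ?cop //; last by lia.
    have -> : ((4 * m).+1 = 4 * (m - (3 * n).+2) + 3 * (4 * n).+3)%N by lia.
    by rewrite dvdn_addl // dvdn_mull.
  (* A cofactor of 4n+3 in 4m+1 is 3 modulo 4, hence at least 3, which would force m >= 3n+2. *)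
  case: dvdnP => // -[[|[|[|k]]] ek]; exfalso; lia.
rewrite /chi_sum -(big_mkord xpredT F) /F -big_mkcond -big_filter.
apply: perm_big; apply: uniq_perm; rewrite ?divisors_uniq ?filter_uniq ?iota_uniq // => d.
rewrite mem_filter mem_index_iota -dvdn_divisors //.
by case: (boolP (d %| _)%N) => // /dvdn_leq dl; have := dl isT; lia.
Qed.

(** * Divisor sums *)

Lemma chi4M m n : chi4 (m * n) = chi4 m * chi4 n.
Proof.
rewrite /chi4 -modnMml -modnMmr.
have := ltn_pmod m (isT : (0 < 4)%N); have := ltn_pmod n (isT : (0 < 4)%N).
move: (m %% 4)%N (n %% 4)%N => x y.
by case: y => [|[|[|[|]]]] // _; case: x => [|[|[|[|]]]].
Qed.

Lemma chi4X p e : chi4 (p ^ e) = chi4 p ^+ e.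
Proof. by elim: e => // e IH; rewrite expnS chi4M IH exprS. Qed.

(** For prime [p] this is D(p^e). *)
Definition chi_geom p e : int := \sum_(i < e.+1) chi4 p ^+ i.

Lemma divisors_pM p e M : prime p -> coprime p M -> (0 < M)%N ->
  perm_eq (divisors (p ^ e.+1 * M))
    (divisors (p ^ e * M) ++ [seq (p ^ e.+1 * d)%N | d <- divisors M]).
Proof.
move=> pp cpM M0; have p0 := prime_gt0 pp.
have inj : injective (muln (p ^ e.+1)).
  by move=> x y /eqP; rewrite eqn_pmul2l ?expn_gt0 ?p0 // => /eqP.
apply: uniq_perm; first exact: divisors_uniq.
  rewrite cat_uniq divisors_uniq map_inj_uniq // divisors_uniq andbT /=.
  apply/hasPn => _ /mapP[d _ ->]; rewrite -dvdn_divisors ?muln_gt0 ?expn_gt0 ?p0 //.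
  apply/negP => dv; have : (p ^ e.+1 %| p ^ e * M)%N by apply: dvdn_trans dv; apply: dvdn_mulr.
  by rewrite expnSr dvdn_pmul2l ?expn_gt0 ?p0 // => dv'; rewrite prime_coprime // dv' in cpM.
move=> d; rewrite mem_cat -!dvdn_divisors ?muln_gt0 ?expn_gt0 ?p0 //.
apply/idP/orP => [dv|[dv|/mapP[d' d'M ->]]]; last 2 first.
- by apply: dvdn_trans dv _; rewrite expnS -mulnA dvdn_mull.
- by rewrite dvdn_pmul2l ?expn_gt0 ?p0 // dvdn_divisors.
have d0 : (0 < d)%N by apply: dvdn_gt0 dv; rewrite muln_gt0 expn_gt0 p0.
have [c cpc ed] := pfactor_coprime pp d0.
have cM : (c %| M)%N.
  rewrite -(@Gauss_dvdr _ (p ^ e.+1)); last by rewrite coprime_sym coprimeXl.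
  by apply: dvdn_trans dv; rewrite ed dvdn_mulr.
have [le|gt] := leqP (logn p d) e.
  by left; rewrite ed mulnC dvdn_mul // dvdn_exp2l.
right; apply/mapP; have dv' : (p ^ e.+1 %| d)%N by rewrite ed dvdn_mull // dvdn_exp2l.
exists (d %/ p ^ e.+1)%N; last by rewrite mulnC divnK.
by rewrite -dvdn_divisors // -(@dvdn_pmul2l (p ^ e.+1)) ?expn_gt0 ?p0 // mulnC divnK.
Qed.

Lemma chi_sum_pM p e M : prime p -> coprime p M -> (0 < M)%N ->
  chi_sum (p ^ e * M) = chi_geom p e * chi_sum M.
Proof.
move=> pp cpM M0; elim: e => [|e IH].
  by rewrite expn0 mul1n /chi_geom big_ord1 mul1r.
rewrite {1}/chi_sum (perm_big _ (divisors_pM e pp cpM M0)) big_cat big_map /=.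
rewrite -/(chi_sum _) IH /chi_geom [in RHS]big_ord_recr mulrDl; congr (_ + _).
by rewrite mulr_sumr; apply: eq_bigr => d _; rewrite chi4M chi4X.
Qed.

Lemma chi_geom_cases p e : chi_geom p e =
  if (p %% 4 == 1)%N then e.+1%:R else if (p %% 4 == 3)%N then (~~ odd e)%:R else 1.
Proof.
rewrite /chi_geom /chi4; case: ifP => _.
  by rewrite (eq_bigr (fun=> 1)) => [|i _]; rewrite ?expr1n // sumr_const card_ord.
case: ifP => _; last first.
  by rewrite big_ord_recl expr0 big1 ?addr0 // => i _; rewrite exprS mul0r.
elim: e => [|e IH]; first by rewrite big_ord1.
by rewrite big_ord_recr IH -signr_odd /=; case: odd.
Qed.

(** Induction on [n], moving the full power of one prime of [n] into [N]. *)
Lemma dvdz4_chi_sum_sqrM n N : (0 < n)%N -> (0 < N)%N ->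
  (forall p, prime p -> (p %| n)%N -> (logn p N <= 1)%N) ->
  (4 %| chi_sum N)%Z -> (4 %| chi_sum (n ^ 2 * N))%Z.
Proof.
elim/ltn_ind: n N => n IH N n0 N0 hN dv.
have [n1|n1] := leqP n 1; first by have -> : n = 1%N; [lia|rewrite mul1n].
pose p := pdiv n; have pp : prime p by apply: pdiv_prime.
have pn : (p %| n)%N by apply: pdiv_dvd.
have [m cpm en] := pfactor_coprime pp n0.
have [M cpM eN] := pfactor_coprime pp N0.
have j0 : (0 < logn p n)%N by rewrite logn_gt0 mem_primes pp n0.
have e1 := hN p pp pn.
move: (logn p n) (logn p N) en eN j0 e1 => j e en eN j0 e1.
have m0 : (0 < m)%N by move: n0; rewrite en muln_gt0 => /andP[].
have M0 : (0 < M)%N by move: N0; rewrite eN muln_gt0 => /andP[].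
have p1 := prime_gt1 pp.
(* The induction hypothesis is used for [m] and p^(2j+e) M; its exponent condition survives because
   [m] is prime to [p]. *)
have -> : (n ^ 2 * N = m ^ 2 * (p ^ (2 * j + e) * M))%N.
  by rewrite en eN expnD mulnC expnM expnMn (expnAC p); ring.
apply: IH => //.
- by rewrite en -[X in (X < _)%N]muln1 ltn_pmul2l // -(expn0 p) ltn_exp2l.
- by rewrite muln_gt0 expn_gt0 prime_gt0.
- move=> r pr rm; have rp : p != r.
    by apply: contraTneq cpm => ->; rewrite prime_coprime // rm.
  have := hN r pr; rewrite {1}en dvdn_mulr // => /(_ isT).
  rewrite eN !lognM ?expn_gt0 ?(prime_gt0 pp) // !lognX !(logn_prime _ pp).
  by rewrite eq_sym (negbTE rp) !muln0 addn0.
move: dv; rewrite eN mulnC !chi_sum_pM //.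
(* D(p^e) divides D(p^(2j+e)): for e = 0 it is 1; for e = 1 the two values are 2 and 2j+2 if p = 1
   mod 4, both 0 if p = 3 mod 4, and both 1 if p = 2. *)
case: e e1 {eN hN} => [|[|]] // _.
  by rewrite {1}/chi_geom big_ord1 expr0 mul1r => dv; apply: dvdz_mull.
move: (chi_sum M) => D; rewrite !chi_geom_cases; case: ifP => _.
  have -> : (2 * j + 1).+1 = (j.+1 * 2)%N by lia.
  by rewrite natrM -mulrA => dv; apply: dvdz_mull.
case: ifP => _ /=; last by rewrite !mul1r.
by rewrite mul2n addn1 /= odd_double mul0r.
Qed.

(** As 3 is 3 modulo 4, D(3^e) depends only on the parity of e. *)
Lemma chi_sum_9M N : (0 < N)%N -> chi_sum (9 * N) = chi_sum N.
Proof.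
move=> N0; have [M cM ->] := pfactor_coprime (isT : prime 3) N0.
have M0 : (0 < M)%N by case: M cM.
have -> : (9 * (M * 3 ^ logn 3 N) = 3 ^ (logn 3 N).+2 * M)%N.
  by rewrite !expnS; lia.
by rewrite (mulnC M) !chi_sum_pM // !chi_geom_cases /= negbK.
Qed.

Lemma logn_sq_part n N p : (0 < N)%N -> coprime n (2 * sq_part N) ->
  prime p -> (p %| n)%N -> (logn p N <= 1)%N.
Proof.
move=> N0 cop pp pn; rewrite leqNgt; apply/negP => lg.
have pN : p \in primes N by rewrite -logn_gt0; lia.
have dv : (p %| 2 * sq_part N)%N.
  rewrite dvdn_mull // /sq_part (big_rem p) //= lg dvdn_mulr //.
  by rewrite dvdn_exp //; lia.
have := coprime_dvdl pn (coprime_dvdr dv cop).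
by rewrite /coprime gcdnn => /eqP e; rewrite e in pp.
Qed.

(** * Passage from 4m+1 to 9 n^2 (4m+1) *)

Lemma coef_psi_sqr m : coef (psi q ^+ 2) m = chi_sum (4 * m).+1.
Proof. by rewrite -chi_sum_lambert lambert4_psi. Qed.

(** If 4K+1 is a square divisible by c^2, its quotient 4m+1 is again a square, necessarily of an odd
    number. *)
Lemma pronic_descent m K c :
  (4 * K).+1 = (c ^ 2 * (4 * m).+1)%N ->
  (exists i, i * i.+1 = K)%N -> exists i, (i * i.+1 = m)%N.
Proof.
move=> e [i ei].
have e2 : ((2 * i).+1 ^ 2 = c ^ 2 * (4 * m).+1)%N by rewrite -e -ei; lia.
have /dvdnP[d ed] : (c %| (2 * i).+1)%N.
  by rewrite -(@dvdn_pexp2r _ _ 2) // e2 dvdn_mulr.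
have c0 : (0 < c)%N by case: c e {e2 ed}.
have e3 : (d ^ 2 = (4 * m).+1)%N.
  apply/eqP; rewrite -(@eqn_pmul2l (c ^ 2)) ?expn_gt0 ?c0 // -e2 ed.
  by rewrite expnMn mulnC.
have : exists t, d = t.*2.+1 \/ d = t.*2 by exists d./2; lia.
by case=> t [ed'|ed']; move: e3; rewrite ed' => e3; [exists t|]; nia.
Qed.

Lemma odd_sqr_mod8 n : odd n -> exists w, (n ^ 2 = (8 * w).+1)%N.
Proof.
move=> on; exists 'C(n./2.+1, 2).
have := bin2_mul n./2.+1; have : n = n./2.*2.+1 by lia.
by move: n./2 => t -> /=; nia.
Qed.

Lemma dvdz8_a_descent m n K : (0 < n)%N ->
  coprime n (2 * sq_part (4 * m + 1)) ->
  (4 * K).+1 = ((3 * n) ^ 2 * (4 * m).+1)%N ->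
  (8 %| a m)%Z -> (8 %| a K)%Z.
Proof.
rewrite addn1 => n0 cop eK am.
have on : odd n by move: cop; rewrite coprimeMr coprimen2 => /andP[].
(* An odd square is 1 modulo 8, so [K] and [m] fall under the same parity case. *)
have oK : odd K = odd m.
  have [w ew] := @odd_sqr_mod8 (3 * n)%N (etrans (oddM 3 n) on).
  have -> : K = (2 * (4 * (w * m) + w) + m)%N.
    by move: eK; rewrite ew; clear; lia.
  by rewrite oddD oddM.
have [om|em] := boolP (odd m); last first.
  have := a_even_mod8 em; have := @a_even_mod8 K; rewrite oK => /(_ em).
  rewrite !coef_psi_q2; case: existsP => [[i /eqP ei]|_]; last lia.
  (* If K = i(i+1), then [m] has the same form and a(m) would be 1 modulo 8. *)
  have [j ej] := pronic_descent eK (ex_intro _ (i : nat) ei).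
  case: existsP => [_|ni]; first by lia.
  have lt_j : (j < m.+1)%N by rewrite ltnS -ej leq_pmulr.
  by case: ni; exists (Ordinal lt_j); apply/eqP.
have := a_odd_mod8 om; have := @a_odd_mod8 K; rewrite oK => /(_ om).
rewrite !coef_psi_sqr eK expnMn -mulnA chi_sum_9M ?muln_gt0 ?expn_gt0 ?n0 //.
move=> hK hm; have h4 : (4 %| chi_sum (4 * m).+1)%Z by lia.
have := dvdz4_chi_sum_sqrM n0 (ltn0Sn _) (fun p => @logn_sq_part _ _ p (ltn0Sn _) cop) h4.
by lia.
Qed.

Theorem theorem1p14 (m : nat) :
  (0 < m)%N -> (8 %| a m)%Z ->
  forall n : nat, (1 <= n)%N ->
    coprime n (2 * sq_part (4 * m + 1)) ->
    (72 %| b (18 * m * n ^ 2 + (9 * n ^ 2 - 1) %/ 2))%Z.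
Proof.
move=> _ am n n0 cop.
have on : odd n by move: cop; rewrite coprimeMr coprimen2 => /andP[].
pose t := n./2; have en : n = t.*2.+1 by lia.
(* With n = 2t+1 the argument of [b] is 2(3k+2), where 4(3k+2) + 1 = 9 n^2 (4m+1); so both the
   congruence modulo 9 and the one modulo 8 apply to it. *)
pose k := (3 * m * n ^ 2 + 3 * (t * t.+1))%N.
have -> : (18 * m * n ^ 2 + (9 * n ^ 2 - 1) %/ 2 = 2 * (3 * k + 2))%N.
  rewrite /k; have -> : (9 * n ^ 2 - 1 = (18 * (t * t.+1) + 4) * 2)%N by nia.
  by rewrite mulnK //; lia.
have eK : ((4 * (3 * k + 2)).+1 = (3 * n) ^ 2 * (4 * m).+1)%N.
  rewrite /k expnMn; move: (m) => M; nia.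
have h8 := dvdz8_a_descent n0 cop eK am.
have := b_a_mod8 (3 * k + 2)%N; have := dvdz9_b k; lia.
Qed.
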